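(* Let $k$ be an algebraically closed field with $\operatorname{char}(k)\neq 2$, let $m\geq 2$, and let $\mathcal{A}=k\langle x_1,\dots,x_n\rangle/I$ with $$I=(x_1,\dots,x_n)^m+\Big(\sum_{i=1}^n a_ix_i\Big),$$ where $a_1,\dots,a_n$ are linearly independent linear combinations of the elements $x_1,\dots,x_n$. Then for every dimension vector $\underline{d}=(d_0,\dots,d_{m-1})$ of non-negative integers the variety $\ker\Phi_{\underline{d}}$ is irreducible. In particular, its open subvariety $\operatorname{rep}(\underline{d},\mathcal{A})$ and the image $\operatorname{rep}_{\underline{d}}(\mathcal{A})$ of the latter under the action of $\operatorname{GL}_d(k)$, $d=\sum_i d_i$, are irreducible. Hence, for every $d$, $$\operatorname{rep}_d(\mathcal{A})=\coprod_{\underline{d}}\operatorname{rep}_{\underline{d}}(\mathcal{A})$$ (the union over all $\underline{d}$ with $\sum_i d_i=d$ that occur as radical layerings of $d$-dimensional $\mathcal{A}$-modules) is a covering of $\operatorname{rep}_d(\mathcal{A})$ by irreducible quasi-affine varieties.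
   Context: $\operatorname{rep}_d(\mathcal{A})$ is the closed subvariety (with reduced structure) of $\operatorname{Mat}_{d\times d}(k)^n$ of tuples $M=(M_1,\dots,M_n)$ satisfying the relations in $I$, identified with $\mathcal{A}$-module structures on $k^d$; $\operatorname{GL}_d(k)$ acts by simultaneous conjugation. For a module $M$, $\operatorname{rad}^iM=(x_1,\dots,x_n)^iM$. For $\underline{d}=(d_0,\dots,d_{m-1})$ with sum $d$, $\operatorname{rep}(\underline{d},\mathcal{A})=\{M\in\operatorname{rep}_d(\mathcal{A}):\operatorname{rad}^iM=\langle e_1,\dots,e_{D_i}\rangle\ \forall i\}$, $D_i=\sum_{j\geq i}d_j$, with $e_1,\dots,e_d$ the standard basis of $k^d$; and $\operatorname{rep}_{\underline{d}}(\mathcal{A})=\operatorname{GL}_d(k)\cdot\operatorname{rep}(\underline{d},\mathcal{A})$. Put $\underline{d}'=(d_1,\dots,d_{m-1})$ (regarded as a radical layering vector of total dimension $d-d_0$, with first layer $d_1$), and let $\operatorname{rep}(\underline{d}',\mathcal{A})$ be defined in the same way. The morphism of trivial vector bundles $$\Phi_{\underline{d}}:\operatorname{rep}(\underline{d}',\mathcal{A})\times\operatorname{Mat}_{(d-d_0)\times d_0}(k)^n\to\operatorname{rep}(\underline{d}',\mathcal{A})\times\operatorname{Mat}_{(d-d_0)\times d_0}(k)$$ is $(M,(N_i)_i)\mapsto\big(M,\sum_{i=1}^n a_i(M)N_i\big)$, where $a_i(M)=\sum_j c_{ij}M_j$ if $a_i=\sum_jc_{ij}x_j$. Its kernel $\ker\Phi_{\underline{d}}=\{(M,(N_i)):\sum_i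 a_i(M)N_i=0\}$ is identified with the set of tuples of block matrices $\begin{pmatrix}M_i&N_i\\0&0\end{pmatrix}$; under this identification $\operatorname{rep}(\underline{d},\mathcal{A})$ is a (possibly empty) open subset of $\ker\Phi_{\underline{d}}$. Irreducibility statements are understood for nonempty varieties. *)

(* Defs.v *)
From mathcomp Require Import all_boot all_order all_algebra.
From mathcomp Require Import finmap monalg mpoly.
(* monalg also declares the notation {mpoly _[_]}, with another meaning, whence
   the explicit mpoly and the qualified names below. *)

Set Implicit Arguments.
Unset Strict Implicit.
Unset Printing Implicit Defensive.

Import GRing.Theory.
Local Open Scope ring_scope.

(* Varieties are given by their sets of k-points inside a finite-dimensional
   k-vector space, with the topology induced by the Zariski topology. *)
Section Zariski.
Variables (k : fieldType) (V : vectType k).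
Implicit Types X Y Z U : V -> Prop.

Definition polyfun (p : mpoly (\dim {:V}) k) (v : V) : k :=
  p.@[fun i => coord (vbasis {:V}) i v].

Definition zariski_closed Z :=
  exists S : mpoly (\dim {:V}) k -> Prop,
    forall v, Z v <-> (forall p, S p -> polyfun p v = 0).

Definition zariski_open U := zariski_closed (fun v => ~ U v).

Definition relatively_open X Y :=
  exists2 U, zariski_open U & forall v, X v <-> U v /\ Y v.

Definition nonempty X := exists v, X v.

Definition irreducible X :=
  nonempty X /\
  forall Z1 Z2, zariski_closed Z1 -> zariski_closed Z2 ->
    (forall v, X v -> Z1 v \/ Z2 v) ->
    (forall v, X v -> Z1 v) \/ (forall v, X v -> Z2 v).

Definition quasi_affine X := exists2 Z, zariski_closed Z & relatively_open X Z.

End Zariski.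

(* Finite sums of elements of S. Every S below is stable under the relevant
   scalars, so that this is the ideal or subspace generated by S. *)
Inductive additive_span (V : zmodType) (S : V -> Prop) : V -> Prop :=
| additive_span0 : additive_span S 0
| additive_spanD u v : S u -> additive_span S v -> additive_span S (u + v).

Section Ideals.
Variable R : nzRingType.
Implicit Types I J : R -> Prop.

Definition ideal_gen (S : R -> Prop) : R -> Prop :=
  additive_span (fun r => exists a s b, S s /\ r = a * s * b).

Definition ideal_add I J : R -> Prop :=
  fun r => exists a b, [/\ I a, J b & r = a + b].

Definition ideal_mul I J : R -> Prop :=
  additive_span (fun r => exists a b, [/\ I a, J b & r = a * b]).

Fixpoint ideal_pow I (i : nat) : R -> Prop :=
  if i is i'.+1 then ideal_mul I (ideal_pow I i') else fun=> True.

End Ideals.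

Definition linearly_independent (k : fieldType) (V : lmodType k) (n : nat)
    (v : 'I_n -> V) :=
  forall l : 'I_n -> k, \sum_i l i *: v i = 0 -> forall i, l i = 0.

(* k<x_1, ..., x_n>, the algebra of the free monoid on 'I_n. *)
Notation free_algebra k n := {malg k[{fmonom 'I_n}]}.

Definition free_var (k : fieldType) (n : nat) (i : 'I_n) : free_algebra k n :=
  mkmalgU (fmu i) 1.

Section Algebra.
Variables (k : fieldType) (n : nat) (c : 'M[k]_n) (m : nat).

Definition linear_comb (i : 'I_n) : free_algebra k n :=
  \sum_j c i j *: free_var k j.

Definition var_ideal : free_algebra k n -> Prop :=
  ideal_gen (fun r => exists i, r = free_var k i).

Definition relation_ideal : free_algebra k n -> Prop :=
  ideal_add (ideal_pow var_ideal m)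
            (ideal_gen (fun r => r = \sum_i linear_comb i * free_var k i)).

End Algebra.

(* Mat_(p x q)(k)^n *)
Notation mxtuple k n p q := {ffun 'I_n -> 'M[k]_(p, q)}.

Section Modules.
Variables (k : fieldType) (n : nat).
Implicit Type d : nat.

Definition eval_free d (M : mxtuple k n d d) (f : free_algebra k n) : 'M[k]_d :=
  \sum_(w <- monalg.msupp f)
    monalg.mcoeff w f *: \prod_(i <- fmonom_val w) M i.

(* rep_d(A): the tuples satisfying all the relations in I *)
Definition rep (c : 'M[k]_n) (m d : nat) (M : mxtuple k n d d) :=
  forall f, relation_ideal c m f -> eval_free M f = 0.

(* rad^i M = (x_1, ..., x_n)^i M, as a set of vectors *)
Definition rad d (M : mxtuple k n d d) (i : nat) : 'cV[k]_d -> Prop :=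
  additive_span (fun u => exists f v,
    ideal_pow (@var_ideal k n) i f /\ u = eval_free M f *m v).

Definition std_flag (d D : nat) : {vspace 'cV[k]_d} :=
  <<[seq delta_mx j ord0 | j <- enum 'I_d & (nat_of_ord j < D)%N]>>%VS.

(* rep(dd, A). The condition bears on every i : nat, so that rad^i M = 0 as soon as
   i >= size dd. It is meant for sumn dd = d; keeping d as a separate
   parameter avoids casts between equal dimensions. *)
Definition rep_flag c m d (dd : seq nat) (M : mxtuple k n d d) :=
  rep c m M /\
  forall i u, rad M i u <-> u \in std_flag d (sumn (drop i dd)).

(* rep_dd(A) = GL_d(k) . rep(dd, A) *)
Definition rep_layer c m d (dd : seq nat) (M : mxtuple k n d d) :=
  exists2 g : 'M[k]_d, g \in unitmx &
    exists2 M' : mxtuple k n d d, rep_flag c m dd M' &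
      forall i, M i = g *m M' i *m invmx g.

(* dim (rad^i M / rad^(i+1) M) = dd_i for all i *)
Definition radical_layering d (M : mxtuple k n d d) (dd : seq nat) :=
  forall i, exists U W : {vspace 'cV[k]_d},
    [/\ forall u, rad M i u <-> u \in U,
        forall u, rad M i.+1 u <-> u \in W &
        \dim U = (\dim W + nth 0 dd i)%N].

Definition occurs c m d (dd : seq nat) :=
  exists2 M : mxtuple k n d d, rep c m M & radical_layering M dd.

Definition linear_comb_act (c : 'M[k]_n) d (M : mxtuple k n d d) (i : 'I_n) :
  'M[k]_d := \sum_j c i j *: M j.

(* Phi depends on dd only through e = d - d_0 and d_0. *)
Definition Phi (c : 'M[k]_n) (e d0 : nat)
    (MN : mxtuple k n e e * mxtuple k n e d0) :
    mxtuple k n e e * 'M[k]_(e, d0) :=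
  (MN.1, \sum_i linear_comb_act c MN.1 i *m MN.2 i).

Definition ker_Phi c m (dd : seq nat)
    (MN : mxtuple k n (sumn (behead dd)) (sumn (behead dd)) *
          mxtuple k n (sumn (behead dd)) (head 0%N dd)) :=
  rep_flag c m (behead dd) MN.1 /\ Phi c MN = (MN.1, 0).

Definition block_tuple (e d0 : nat) (MN : mxtuple k n e e * mxtuple k n e d0) :
    mxtuple k n (e + d0) (e + d0) :=
  [ffun i => block_mx (MN.1 i) (MN.2 i) 0 0].

End Modules.

(* Main.v *)
Require Import Defs.
From mathcomp Require Import all_boot all_order all_algebra.
From mathcomp Require Import finmap monalg mpoly.
From Stdlib Require Import Classical.

Set Implicit Arguments.
Unset Strict Implicit.
Unset Printing Implicit Defensive.

Import GRing.Theory.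
Local Open Scope ring_scope.

(** Fix dd = (d_0, ..., d_(m-1)) and let dd' drop d_0.  The fibre of ker Phi
    over M in rep(dd', A) is the kernel of the linear map sending (N_i) to
    sum_i a_i(M) N_i.  Since c is invertible, the a_i span the same space as the
    x_j, so the image of this map consists of all matrices with columns in
    rad M; and rad M is the same coordinate subspace for all M in rep(dd', A).
    A family of linear maps with constant image has a kernel that varies
    regularly, so ker Phi is a vector bundle over rep(dd', A).  Instead of local
    trivializations, the proof uses only that every point of ker Phi lies on a
    global regular section over rep(dd', A), given by Cramer's rule
    (opens_meet_kernel); together with irreducible fibres and an irreducible base,
    this suffices (opens_meet_fibration).

    In block form, rep(dd, A) is the part of ker Phi where the blocks M_i, N_i
    together generate the whole radical (rep_flag_block), an open condition.
    Induction on the number of layers therefore gives the irreducibility of both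
    ker Phi and rep(dd, A) (opens_meet_rep_flag).

    The relations are homogeneous, so rep(dd, A) is stable under scaling and
    g M g^-1 may be replaced by g M adj(g).  Hence rep_dd(A) is the image of
    GL_d x rep(dd, A) under a polynomial map, and is irreducible
    (opens_meet_rep_layer).

    Finally, a basis adapted to the radical filtration shows that rep_dd(A)
    consists of the solutions of the quadratic relation for which rad^i M has
    dimension D_i = d_i + d_(i+1) + ... for every i (rep_layerP); since D_m = 0,
    this includes the nilpotency relation.  The strata are thus disjoint and
    cover rep_d(A).  They are locally closed because a lower bound on
    dim rad^i M is an open condition (rad_dim_ge_open). *)

(** * Regular functions and irreducibility *)

Section Regular.
Variable k : fieldType.

(** The polynomial functions on V. Presented as a closure, they can be treated by
    induction, and no coordinates are needed to show that a given function is one. *)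
Inductive regular (V : vectType k) : (V -> k) -> Prop :=
| regular_const a : regular (fun=> a)
| regular_form f : scalar f -> regular f
| regularD f g : regular f -> regular g -> regular (fun v => f v + g v)
| regularM f g : regular f -> regular g -> regular (fun v => f v * g v)
| regular_ext f g : regular f -> f =1 g -> regular g.

Variable V : vectType k.
Implicit Types f g : V -> k.

Lemma scalar_form_morph f : scalar f ->
  [/\ {morph f : u v / u + v}, f 0 = 0 & forall a u, f (a *: u) = a * f u].
Proof.
move=> flin; have f0 : f 0 = 0.
  by have := flin (-1) 0 0; rewrite scaler0 add0r mulN1r addNr.
split=> // [u v|a u]; first by have := flin 1 u v; rewrite scale1r mul1r.
by have := flin a u 0; rewrite f0 !addr0.
Qed.

Lemma regularN f : regular f -> regular (fun v => - f v).
Proof.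
move=> rf; apply: (regular_ext (regularM (regular_const _ (-1)) rf)) => v.
by rewrite mulN1r.
Qed.

Lemma regular_sum (I : Type) (r : seq I) (P : pred I) (F : I -> V -> k) :
  (forall i, P i -> regular (F i)) -> regular (fun v => \sum_(i <- r | P i) F i v).
Proof.
move=> rF; elim: r => [|i r IH].
  by apply: (regular_ext (regular_const _ 0)) => v; rewrite big_nil.
have [Pi|nPi] := boolP (P i).
  by apply: (regular_ext (regularD (rF i Pi) IH)) => v; rewrite big_cons Pi.
by apply: (regular_ext IH) => v; rewrite big_cons (negbTE nPi).
Qed.

Lemma regular_prod (I : Type) (r : seq I) (P : pred I) (F : I -> V -> k) :
  (forall i, P i -> regular (F i)) ->
  regular (fun v => \prod_(i <- r | P i) F i v).
Proof.
move=> rF; elim: r => [|i r IH].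
  by apply: (regular_ext (regular_const _ 1)) => v; rewrite big_nil.
have [Pi|nPi] := boolP (P i).
  by apply: (regular_ext (regularM (rF i Pi) IH)) => v; rewrite big_cons Pi.
by apply: (regular_ext IH) => v; rewrite big_cons (negbTE nPi).
Qed.

Lemma polyfun_regular (p : mpoly (\dim {:V}) k) : regular (polyfun p).
Proof.
have: regular (fun v : V => \sum_(m <- mpoly.msupp p)
    mpoly.mcoeff m p * \prod_i \prod_(j < m i) coord (vbasis {:V}) i v).
  apply: regular_sum => m _; apply: regularM; first exact: regular_const.
  apply: regular_prod => i _; apply: regular_prod => j _.
  by apply: regular_form => a u v; rewrite linearP.
move/regular_ext; apply=> v; rewrite /polyfun mevalE.
apply: eq_bigr => m _; congr (_ * _); apply: eq_bigr => i _.
by rewrite prodr_const card_ord.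
Qed.

Lemma regular_polyfun f : regular f ->
  exists p : mpoly (\dim {:V}) k, forall v, polyfun p v = f v.
Proof.
elim=> [a|h hlin|f1 f2 _ [p1 e1] _ [p2 e2]|f1 f2 _ [p1 e1] _ [p2 e2]
       |f1 f2 _ [p1 e1] e].
- by exists (mpolyC _ a) => v; rewrite /polyfun mevalC.
- exists (\sum_(i < \dim {:V}) h (vbasis {:V})`_i *: mpolyX k (mnm1 i)) => v.
  rewrite /polyfun raddf_sum /=.
  rewrite [in RHS](coord_vbasis (memvf v)).
  have [hD h0 hZ] := scalar_form_morph hlin.
  rewrite (big_morph h hD h0); apply: eq_bigr => i _.
  by rewrite hZ mevalZ mevalXU mulrC.
- by exists (p1 + p2) => v; rewrite /polyfun mevalD -e1 -e2.
- by exists (p1 * p2) => v; rewrite /polyfun mevalM -e1 -e2.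
- by exists p1 => v; rewrite e1 e.
Qed.

(** The equations may be given as functions, for S can be replaced by the set of
    all polynomials that represent its members. *)
Lemma zariski_closed_zeros (S : (V -> k) -> Prop) (Z : V -> Prop) :
    (forall f, S f -> regular f) ->
    (forall v, Z v <-> forall f, S f -> f v = 0) ->
  zariski_closed Z.
Proof.
move=> regS defZ; exists (fun p => exists2 f, S f & forall v, polyfun p v = f v).
move=> v; rewrite defZ; split=> [Zv p [f Sf ->]|Zv f Sf]; first exact: Zv.
have [p pf] := regular_polyfun (regS f Sf).
by rewrite -pf; apply: Zv; exists f.
Qed.

Lemma zariski_open_nonzeros (S : (V -> k) -> Prop) (U : V -> Prop) :
    (forall f, S f -> regular f) ->
    (forall v, U v <-> exists2 f, S f & f v != 0) ->
  zariski_open U.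
Proof.
move=> regS defU; apply: (zariski_closed_zeros regS) => v; rewrite defU.
split=> [nU f Sf|Z [f Sf]]; last by rewrite Z ?eqxx.
by apply/eqP; apply: contra_notT nU => fv; exists f.
Qed.

Lemma zariski_open_nonzerosP (U : V -> Prop) : zariski_open U ->
  forall v, U v -> exists f, [/\ regular f, f v != 0 & forall w, f w != 0 -> U w].
Proof.
move=> [S defU] v Uv; apply: NNPP => nof; have: ~ ~ U v by move=> nU.
apply; apply/defU => p Sp; apply/eqP; apply: contra_notT nof => pv.
exists (polyfun p); split=> //; first exact: polyfun_regular.
move=> w pw; apply: NNPP => /defU /(_ p Sp) p0; by rewrite p0 eqxx in pw.
Qed.

Lemma zariski_closedI (I : Type) (Z : I -> V -> Prop) :
  (forall i, zariski_closed (Z i)) -> zariski_closed (fun v => forall i, Z i v).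
Proof.
move=> clZ.
apply: (@zariski_closed_zeros (fun f => regular f /\
          exists i, forall v, Z i v -> f v = 0)) => [f []//|v].
split=> [Zv f [_ [i Zf]]|Zv i]; first exact: Zf.
have [S defZ] := clZ i; apply/defZ => p Sp; apply: Zv; split.
  exact: polyfun_regular.
by exists i => w /defZ; apply.
Qed.

Lemma zariski_openI (U1 U2 : V -> Prop) :
  zariski_open U1 -> zariski_open U2 -> zariski_open (fun v => U1 v /\ U2 v).
Proof.
move=> o1 o2.
apply: (@zariski_open_nonzeros (fun f => regular f /\
          forall w, f w != 0 -> U1 w /\ U2 w)) => [f []//|v]; split=> [|[f [_]]].
  case=> /(zariski_open_nonzerosP o1)[f1 [r1 n1 s1]].
  move=> /(zariski_open_nonzerosP o2)[f2 [r2 n2 s2]].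
  exists (fun v => f1 v * f2 v); last by rewrite mulf_neq0.
  split=> [|w]; first exact: regularM.
  by rewrite mulf_eq0 negb_or => /andP[/s1 ? /s2 ?].
by move=> /[apply].
Qed.

Lemma zariski_open_bigI (m : nat) (U : nat -> V -> Prop) :
    (forall i, zariski_open (U i)) ->
  zariski_open (fun v => forall i, (i < m)%N -> U i v).
Proof.
move=> oU; elim: m => [|m IH].
  apply: (@zariski_open_nonzeros (fun f => regular f)) => // v; split=> // _.
  by exists (fun=> 1); [exact: regular_const | exact: oner_neq0].
have [S defS] := zariski_openI IH (oU m).
exists S => v; rewrite -defS; split=> nU; apply: contra_not nU.
  by move=> [Ulm Um] i; rewrite ltnS leq_eqVlt => /predU1P[->|/Ulm].
by move=> Uv; split=> [i /ltnW|]; apply: Uv.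
Qed.

End Regular.

Definition regular_map (k : fieldType) (V W : vectType k) (s : V -> W) :=
  forall f, regular f -> regular (fun v => f (s v)).

Section RegularMap.
Variable k : fieldType.
Implicit Types U V W : vectType k.

Lemma regular_mapP V W (s : V -> W) :
  (forall f, scalar f -> regular (fun v => f (s v))) -> regular_map s.
Proof.
move=> rs f; elim=> [a|h /rs//|f1 f2 _ r1 _ r2|f1 f2 _ r1 _ r2|f1 f2 _ r1 e].
- exact: regular_const.
- exact: regularD.
- exact: regularM.
- by apply: (regular_ext r1) => v; rewrite e.
Qed.

Lemma regular_map_id V : regular_map (@id V).
Proof. by []. Qed.

Lemma regular_map_const V W (w : W) : regular_map (fun _ : V => w).
Proof. by move=> f _; apply: regular_const. Qed.

Lemma regular_map_linear V W (s : V -> W) : linear s -> regular_map s.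
Proof.
move=> slin; apply: regular_mapP => l llin; apply: regular_form => a u v.
by rewrite slin llin.
Qed.

Lemma regular_map_pair U V W (s : U -> V) (t : U -> W) :
  regular_map s -> regular_map t -> regular_map (fun u => (s u, t u)).
Proof.
move=> rs rt; apply: regular_mapP => l llin.
apply: (@regular_ext _ _ (fun u => l (s u, 0) + l (0, t u))).
  apply: regularD.
    apply: (rs (fun v => l (v, 0))); apply: regular_form => a x y.
    by rewrite -llin; congr l; apply/pair_equal_spec; split;
      rewrite //= scaler0 addr0.
  apply: (rt (fun w => l (0, w))); apply: regular_form => a x y.
  by rewrite -llin; congr l; apply/pair_equal_spec; split;
    rewrite //= scaler0 addr0.
move=> u; have := llin 1 (s u, 0) (0, t u).
rewrite mul1r scale1r => <-; congr l; apply/pair_equal_spec.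
by rewrite /= addr0 add0r.
Qed.

Lemma zariski_open_preimage V W (s : V -> W) (O : W -> Prop) :
  regular_map s -> zariski_open O -> zariski_open (fun v => O (s v)).
Proof.
move=> rs oU.
apply: (@zariski_open_nonzeros _ _ (fun f => exists g,
   [/\ regular g, forall v, f v = g (s v) & forall w, g w != 0 -> O w])).
  by move=> f [g [rg e _]]; apply: (regular_ext (rs g rg)) => v; rewrite e.
move=> v; split=> [/(zariski_open_nonzerosP oU)[g [rg nz sub]]|].
  by exists (fun v => g (s v)) => //; exists g.
by case=> f [g [_ -> sub]] /sub.
Qed.

(** Irreducibility up to nonemptiness: any two nonempty basic open subsets of X
    have a common point.  Unlike the formulation by closed coverings, this one is
    transported along maps by composing functions. *)
Definition opens_meet V (X : V -> Prop) :=
  forall f g, regular f -> regular g ->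
  forall x y, X x -> X y -> f x != 0 -> g y != 0 ->
  exists z, [/\ X z, f z != 0 & g z != 0].

Lemma opens_meet_irreducible V (X : V -> Prop) :
  opens_meet X -> nonempty X -> irreducible X.
Proof.
move=> meetX neX; split=> // Z1 Z2 [S1 def1] [S2 def2] cov.
apply: NNPP => /not_or_and[].
move=> /not_all_ex_not[x xP]; have [Xx nZ1] := imply_to_and _ _ xP.
move=> /not_all_ex_not[y yP]; have [Xy nZ2] := imply_to_and _ _ yP.
have noZ (S : mpoly (\dim {:V}) k -> Prop) v : ~ (forall p, S p -> polyfun p v = 0) ->
    exists2 p, S p & polyfun p v != 0.
  move=> nS; apply: NNPP => nex; apply: nS => p Sp; apply/eqP.
  by apply: contra_notT nex => pv; exists p.
have [p Sp px] : exists2 p, S1 p & polyfun p x != 0 by apply: noZ; rewrite -def1.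
have [q Sq qy] : exists2 q, S2 q & polyfun q y != 0 by apply: noZ; rewrite -def2.
have [z [Xz pz qz]] :=
  meetX _ _ (polyfun_regular p) (polyfun_regular q) x y Xx Xy px qy.
by case: (cov z Xz) => [/def1/(_ p Sp)|/def2/(_ q Sq)]/eqP; apply/negP.
Qed.

Lemma opens_meet_ext V (X Y : V -> Prop) :
  (forall v, X v <-> Y v) -> opens_meet X -> opens_meet Y.
Proof.
move=> eXY mX f g rf rg x y /eXY Xx /eXY Xy fx gy.
by have [z [/eXY Yz fz gz]] := mX f g rf rg x y Xx Xy fx gy; exists z.
Qed.

Lemma opens_meet_image V W (s : V -> W) (X : V -> Prop) :
  regular_map s -> opens_meet X -> opens_meet (fun w => exists2 v, X v & w = s v).
Proof.
move=> rs mX f g rf rg _ _ [x Xx ->] [y Xy ->] fx gy.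
have [z [Xz fz gz]] := mX _ _ (rs f rf) (rs g rg) x y Xx Xy fx gy.
by exists (s z); split=> //; exists z.
Qed.

Lemma opens_meet_open V (X O : V -> Prop) :
  zariski_open O -> opens_meet X -> opens_meet (fun v => O v /\ X v).
Proof.
move=> oO mX f g rf rg x y [Ox Xx] [Oy Xy] fx gy.
have [p [rp px sp]] := zariski_open_nonzerosP oO Ox.
have [q [rq qy _]] := zariski_open_nonzerosP oO Oy.
have fpx : f x * p x != 0 by rewrite mulf_neq0.
have gqy : g y * q y != 0 by rewrite mulf_neq0.
have [z [Xz]] := mX _ _ (regularM rf rp) (regularM rg rq) x y Xx Xy fpx gqy.
rewrite !mulf_eq0 !negb_or => /andP[fz pz] /andP[gz qz].
by exists z; split=> //; split=> //; apply: sp.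
Qed.

(** A regular function restricted to a line is a polynomial in the parameter.
    This reduces density questions on linear subspaces to polynomials in one
    variable. *)
Lemma regular_on_line V (f : V -> k) (x y : V) :
  regular f -> exists p : {poly k}, forall t, f (x + t *: y) = p.[t].
Proof.
elim=> [a|h hlin|f1 f2 _ [p1 e1] _ [p2 e2]|f1 f2 _ [p1 e1] _ [p2 e2]
       |f1 f2 _ [p1 e1] e].
- by exists a%:P => t; rewrite hornerC.
- exists ((h x)%:P + (h y) *: 'X) => t.
  by rewrite !hornerE addrC hlin mulrC addrC.
- by exists (p1 + p2) => t; rewrite e1 e2 hornerD.
- by exists (p1 * p2) => t; rewrite e1 e2 hornerM.
- by exists p1 => t; rewrite -e.
Qed.

(** Let f and g be nonzero at two points of E.  Pulled back along regular sections
    through these points, they become regular functions on B that are nonzero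
    somewhere, hence both nonzero at a common b.  The fibre over b then meets both
    open sets, and it is irreducible. *)
Lemma opens_meet_fibration V W (B : V -> Prop) (E : V * W -> Prop) :
    opens_meet B ->
    (forall b, B b -> opens_meet (fun w => E (b, w))) ->
    (forall b w, E (b, w) -> B b) ->
    (forall b w, E (b, w) -> exists s : V -> W,
       [/\ regular_map s, s b = w & forall b', B b' -> E (b', s b')]) ->
  opens_meet E.
Proof.
move=> mB mF proj sect f g rf rg [b v] [c w] Ebv Ecw fbv gcw.
have reg_graph (h : V * W -> k) (s : V -> W) :
    regular h -> regular_map s -> regular (fun b => h (b, s b)).
  by move=> rh rs; apply: (regular_map_pair (@regular_map_id V) rs).
have reg_fiber (h : V * W -> k) (b0 : V) : regular h -> regular (fun w => h (b0, w)).
  move=> rh.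
  by apply: (regular_map_pair (@regular_map_const W V b0) (@regular_map_id W)).
have [s [rs sb Es]] := sect _ _ Ebv; have [t [rt tc Et]] := sect _ _ Ecw.
have fb : f (b, s b) != 0 by rewrite sb.
have gc : g (c, t c) != 0 by rewrite tc.
have [z [Bz fz gz]] := mB _ _ (reg_graph _ _ rf rs) (reg_graph _ _ rg rt)
  b c (proj _ _ Ebv) (proj _ _ Ecw) fb gc.
have [u [Eu fu gu]] := mF z Bz _ _ (reg_fiber f z rf) (reg_fiber g z rg)
   (s z) (t z) (Es z Bz) (Et z Bz) fz gz.
by exists (z, u).
Qed.

End RegularMap.

Section Irreducibility.
Variable k : closedFieldType.
Implicit Types U V W : vectType k.

Lemma nonroot2 (p q : {poly k}) a b :
  p.[a] != 0 -> q.[b] != 0 -> exists t, p.[t] != 0 /\ q.[t] != 0.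
Proof.
move=> pa qb.
have pq0 : p * q != 0.
  by rewrite mulf_neq0 //; [apply: contraNneq pa|apply: contraNneq qb] => ->;
    rewrite horner0.
have [t] := closed_nonrootP (p * q) pq0.
by rewrite rootM negb_or => /andP[pt qt]; exists t.
Qed.

(** Two points of a linear subspace are joined by a line inside it, and two nonzero
    polynomials in one variable have a common non-root because k is infinite. *)
Lemma opens_meet_subspace V (X : V -> Prop) :
  (forall a u v, X u -> X v -> X (a *: u + v)) -> opens_meet X.
Proof.
move=> linX f g rf rg x y Xx Xy fx gy.
have [p ep] := regular_on_line x (y - x) rf.
have [q eq] := regular_on_line x (y - x) rg.
have p0 : p.[0] != 0 by rewrite -ep scale0r addr0.
have q1 : q.[1] != 0 by rewrite -eq scale1r addrC subrK.
have [t [pt qt]] := nonroot2 p0 q1.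
exists (x + t *: (y - x)); rewrite ep eq; split=> //.
have -> : x + t *: (y - x) = t *: ((-1) *: x + y) + x.
  by rewrite addrC scaleN1r [- x + y]addrC.
by apply: (linX _ _ _) => //; apply: linX.
Qed.

End Irreducibility.

(** * The radical filtration and the relations *)

Section AdditiveSpan.
Variables (V : zmodType) (S : V -> Prop).

Lemma additive_span_mem u : S u -> additive_span S u.
Proof. by move=> Su; rewrite -[u]addr0; apply: additive_spanD; [|constructor]. Qed.

Lemma additive_span_add u v :
  additive_span S u -> additive_span S v -> additive_span S (u + v).
Proof.
by move=> Su Sv; elim: Su => [|x y Sx _ IH]; rewrite ?add0r // -addrA;
  apply: additive_spanD.
Qed.

Lemma additive_span_sum (I : Type) (r : seq I) (F : I -> V) :
  (forall i, additive_span S (F i)) -> additive_span S (\sum_(i <- r) F i).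
Proof.
move=> SF; apply: (big_ind (additive_span S)) => //; first by constructor.
exact: additive_span_add.
Qed.

End AdditiveSpan.

Section Eval.
Variables (k : fieldType) (n d : nat) (M : mxtuple k n d d).
Implicit Types f g : free_algebra k n.

Lemma eval_freeEw (D : {fset {fmonom 'I_n}}) f :
  (monalg.msupp f `<=` D)%fset ->
  eval_free M f = \sum_(w <- D) monalg.mcoeff w f *: \prod_(i <- fmonom_val w) M i.
Proof.
move=> sD; rewrite /eval_free (big_fset_incl _ sD) //= => w _.
by move/monalg.mcoeff_outdom=> ->; rewrite scale0r.
Qed.

Lemma eval_freeD f g : eval_free M (f + g) = eval_free M f + eval_free M g.
Proof.
set D := (monalg.msupp f `|` monalg.msupp g)%fset.
rewrite !(@eval_freeEw D) ?fsubsetUl ?fsubsetUr ?monalg.msuppD_le //.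
rewrite -big_split /=; apply: eq_bigr => w _.
by rewrite monalg.mcoeffD scalerDl.
Qed.

Lemma eval_free0 : eval_free M 0 = 0.
Proof. by rewrite /eval_free monalg.msupp0 big_seq_fset0. Qed.

Lemma eval_free_sum (I : Type) (r : seq I) (P : pred I) (F : I -> free_algebra k n) :
  eval_free M (\sum_(i <- r | P i) F i) = \sum_(i <- r | P i) eval_free M (F i).
Proof. exact: (big_morph _ eval_freeD eval_free0). Qed.

Lemma eval_freeZ a f : eval_free M (a *: f) = a *: eval_free M f.
Proof.
rewrite (eval_freeEw (monalg.msuppZ_le a f)) /eval_free scaler_sumr.
by apply: eq_bigr => w _; rewrite monalg.mcoeffZ scalerA.
Qed.

Lemma eval_free_monomial a (w : {fmonom 'I_n}) :
  eval_free M (monalg.mkmalgU w a) = a *: \prod_(i <- fmonom_val w) M i.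
Proof.
by rewrite (eval_freeEw monalg.msuppU_le) big_seq_fset1 monalg.mcoeffUU.
Qed.

Lemma eval_free_var i : eval_free M (free_var k i) = M i.
Proof. by rewrite /free_var (eval_free_monomial 1 (fmu i)) fmU big_seq1 scale1r. Qed.

Lemma eval_free1 : eval_free M 1 = 1%:M.
Proof.
by rewrite (eval_free_monomial 1 (@monalg.mone _)) fm1 big_nil scale1r.
Qed.

Lemma eval_freeM f g : eval_free M (f * g) = eval_free M f *m eval_free M g.
Proof.
rewrite monalg.malgME eval_free_sum [eval_free M f]/eval_free mulmx_suml.
apply: eq_bigr => w _; rewrite eval_free_sum [eval_free M g]/eval_free mulmx_sumr.
apply: eq_bigr => w' _; rewrite eval_free_monomial fmM big_cat /=.
by rewrite -scalemxAl -scalemxAr scalerA.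
Qed.

Lemma eval_free_linear_comb (c : 'M[k]_n) i :
  eval_free M (linear_comb c i) = linear_comb_act c M i.
Proof.
by rewrite eval_free_sum; apply: eq_bigr => j _; rewrite eval_freeZ eval_free_var.
Qed.

End Eval.

Section RadSpace.
Variables (k : fieldType) (n d : nat).
Implicit Type M : mxtuple k n d d.

(** rad^i M as a vector space, by the recursion rad^(i+1) M = sum_j M_j (rad^i M)
    that avoids ideals of the free algebra. *)
Fixpoint rad_space M (i : nat) : {vspace 'cV[k]_d} :=
  if i is i'.+1 then (\sum_j (linfun (mulmx (M j)) @: rad_space M i'))%VS
  else fullv.

Lemma mem_rad_spaceS M i u :
  reflect (exists2 v : 'I_n -> 'cV[k]_d, forall j, v j \in rad_space M i &
             u = \sum_j M j *m v j)
          (u \in rad_space M i.+1).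
Proof.
apply: (iffP memv_sumP) => [[us us_in ->]|[v v_in ->]].
  have /fin_all_exists[v vP] (j : 'I_n) :
      exists v, v \in rad_space M i /\ us j = M j *m v.
    by have /memv_imgP[v v_in ->] := us_in j isT; exists v; rewrite lfunE.
  by exists v => [j|]; [have [] := vP j | apply: eq_bigr => j _; have [] := vP j].
exists (fun j => M j *m v j) => // j _.
by apply/memv_imgP; exists (v j); rewrite ?lfunE.
Qed.

Lemma mem_rad_space_act M i j u : u \in rad_space M i -> M j *m u \in rad_space M i.+1.
Proof.
move=> u_in; apply/mem_rad_spaceS; exists (fun l => if l == j then u else 0).
  by move=> l; case: eqP; rewrite ?mem0v.
rewrite (bigD1 j) //= eqxx big1 ?addr0 // => l /negbTE->.
by rewrite mulmx0.
Qed.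

Lemma rad_space_decr M i : (rad_space M i.+1 <= rad_space M i)%VS.
Proof.
elim: i => [|i IH]; first exact: subvf.
apply/subvP => u /mem_rad_spaceS[v v_in ->]; apply/mem_rad_spaceS.
by exists v => // j; apply: (subvP IH).
Qed.

Lemma rad_space_eval M i f u : u \in rad_space M i -> eval_free M f *m u \in rad_space M i.
Proof.
move=> u_in; rewrite /eval_free mulmx_suml; apply: memv_suml => w _.
rewrite -scalemxAl; apply: memvZ; elim: (fmonom_val w) => [|j s IH].
  by rewrite big_nil mul1mx.
rewrite big_cons -mulmxA.
by apply: (subvP (rad_space_decr _ _)); apply: mem_rad_space_act.
Qed.

Lemma rad_space_pow M i f u :
  ideal_pow (@var_ideal k n) i f -> eval_free M f *m u \in rad_space M i.
Proof.
elim: i f u => [f u _|i IH f u]; first exact: memvf.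
elim=> [|g h [a [b [Ia Ib ->]]] _ Ih]; first by rewrite eval_free0 mul0mx mem0v.
rewrite eval_freeD mulmxDl memvD // eval_freeM -mulmxA.
have: eval_free M b *m u \in rad_space M i by apply: IH.
elim: Ia {IH Ib Ih} (eval_free M b *m u) => [|a1 a2 [p [x [q [[j ->] ->]]]] _ Ia2] v v_in.
  by rewrite eval_free0 mul0mx mem0v.
rewrite eval_freeD mulmxDl memvD ?Ia2 // !eval_freeM -!mulmxA eval_free_var.
by apply: rad_space_eval; apply: mem_rad_space_act; apply: rad_space_eval.
Qed.

(** From left to right, rad^i M is stable under every M_j and x_j maps it into
    rad^(i+1) M.  From right to left, every vector of rad_space is a sum of words
    of length i applied to vectors. *)
Lemma rad_spaceP M i u : Defs.rad M i u <-> u \in rad_space M i.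
Proof.
split=> [|u_in].
  elim=> [|_ w [f [v [If ->]]] _ w_in]; first exact: mem0v.
  by rewrite memvD // rad_space_pow.
elim: i u u_in => [|i IH] u u_in.
  apply: additive_span_mem; exists 1, u; split=> //.
  by rewrite eval_free1 mul1mx.
case/mem_rad_spaceS: u_in => v v_in ->; apply: additive_span_sum => j.
elim: (IH (v j) (v_in j)) => [|_ w [f [x [If ->]]] _ IHw].
  by rewrite mulmx0; constructor.
rewrite mulmxDr; apply: additive_spanD => //; exists (free_var k j * f), x.
split; last by rewrite eval_freeM eval_free_var mulmxA.
apply: additive_span_mem; exists (free_var k j), f; split=> //.
apply: additive_span_mem; exists 1, (free_var k j), 1.
by split; [exists j | rewrite mul1r mulr1].
Qed.

Definition relation_act (c : 'M[k]_n) M : 'M[k]_d :=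
  \sum_i linear_comb_act c M i *m M i.

Lemma repP c m M : rep c m M <-> rad_space M m = 0%VS /\ relation_act c M = 0.
Proof.
have eval_rel : eval_free M (\sum_i linear_comb c i * free_var k i) = relation_act c M.
  rewrite eval_free_sum; apply: eq_bigr => i _.
  by rewrite eval_freeM eval_free_linear_comb eval_free_var.
split=> [repM|[R0 rel0] f [a [b [Ia Ib ->]]]].
  split.
    apply/eqP; rewrite -subv0; apply/subvP => u /rad_spaceP.
    elim=> [|_ w [f [v [If ->]]] _ w_in]; first exact: mem0v.
    rewrite memvD // repM ?mul0mx ?mem0v //.
    by exists f, 0; split; [|constructor|rewrite addr0].
  rewrite -eval_rel; apply: repM; exists 0, (\sum_i linear_comb c i * free_var k i).
  split; last by rewrite add0r.
    by case: (m) => //= m'; constructor.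
  apply: additive_span_mem; exists 1, (\sum_i linear_comb c i * free_var k i), 1.
  by split=> //; rewrite mul1r mulr1.
rewrite eval_freeD; have -> : eval_free M a = 0.
  apply/matrixP => i j; have := rad_space_pow M (delta_mx j 0) Ia.
  by rewrite R0 memv0 -colE => /eqP/matrixP/(_ i 0); rewrite !mxE.
rewrite add0r; elim: Ib => [|g h [p [r [q [-> ->]]]] _ Ih]; first exact: eval_free0.
by rewrite eval_freeD Ih addr0 !eval_freeM eval_rel rel0 mulmx0 mul0mx.
Qed.

Lemma mem_std_flag D (u : 'cV[k]_d) :
  reflect (forall j : 'I_d, (D <= j)%N -> u j 0 = 0) (u \in std_flag k d D).
Proof.
apply: (iffP idP) => [|u0].
  pose Z := [pred u : 'cV[k]_d | [forall j : 'I_d, (D <= j)%N ==> (u j 0 == 0)]].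
  move=> u_in; suff /forallP uZ : Z u by move=> j /(implyP (uZ j))/eqP.
  rewrite (coord_span (X := in_tuple _) u_in); elim/big_ind: _ => [|x y /forallP x0 /forallP y0|i _].
  - by apply/forallP => j; rewrite mxE eqxx implybT.
  - apply/forallP => j; apply/implyP => Dj; rewrite mxE.
    by rewrite (eqP (implyP (x0 j) Dj)) (eqP (implyP (y0 j) Dj)) addr0.
  apply/forallP => j; apply/implyP => Dj; rewrite mxE.
  have /mapP[l] := mem_nth 0 (ltn_ord i).
  rewrite mem_filter => /andP[lD _] ->; rewrite mxE eqxx andbT.
  have /negbTE-> : j != l by apply: contraTneq lD => <-; rewrite -leqNgt.
  by rewrite mulr0.
rewrite [u](matrix_sum_delta) exchange_big big_ord1 /=.
apply: memv_suml => j _; have [jD|Dj] := ltnP j D; last first.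
  by rewrite u0 // scale0r mem0v.
apply: memvZ; apply: memv_span; apply/mapP; exists j => //.
by rewrite mem_filter jD mem_enum.
Qed.

Lemma rep_flagP c m (dd : seq nat) M :
  rep_flag c m dd M <->
  [/\ rad_space M m = 0%VS, relation_act c M = 0 &
      forall i, rad_space M i = std_flag k d (sumn (drop i dd))].
Proof.
rewrite /rep_flag repP; split=> [[[R0 rel0] fl]|[R0 rel0 fl]].
  split=> // i; apply/vspaceP => u; apply/idP/idP; last by move/fl/rad_spaceP.
  by move/rad_spaceP/fl.
by split=> // i u; rewrite rad_spaceP fl.
Qed.

End RadSpace.

(** * Openness of the rank conditions *)

Definition mxregular (k : fieldType) (V : vectType k) (p q : nat)
    (s : V -> 'M[k]_(p, q)) :=
  forall a b, regular (fun v => s v a b).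

Section MxRegular.
Variables (k : fieldType) (V : vectType k).

Lemma mxregular_ext p q (s t : V -> 'M[k]_(p, q)) :
  mxregular s -> s =1 t -> mxregular t.
Proof. by move=> rs e a b; apply: (regular_ext (rs a b)) => v; rewrite e. Qed.

Lemma mxregular_const p q (A : 'M[k]_(p, q)) : mxregular (fun _ : V => A).
Proof. by move=> a b; apply: regular_const. Qed.

Lemma mxregularD p q (s t : V -> 'M[k]_(p, q)) :
  mxregular s -> mxregular t -> mxregular (fun v => s v + t v).
Proof.
move=> rs rt a b; apply: (regular_ext (regularD (rs a b) (rt a b))) => v.
by rewrite mxE.
Qed.

Lemma mxregularN p q (s : V -> 'M[k]_(p, q)) :
  mxregular s -> mxregular (fun v => - s v).
Proof. by move=> rs a b; apply: (regular_ext (regularN (rs a b))) => v; rewrite mxE. Qed.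

Lemma mxregularZ p q (f : V -> k) (s : V -> 'M[k]_(p, q)) :
  regular f -> mxregular s -> mxregular (fun v => f v *: s v).
Proof.
by move=> rf rs a b; apply: (regular_ext (regularM rf (rs a b))) => v; rewrite mxE.
Qed.

Lemma mxregularM p q r (s : V -> 'M[k]_(p, q)) (t : V -> 'M[k]_(q, r)) :
  mxregular s -> mxregular t -> mxregular (fun v => s v *m t v).
Proof.
move=> rs rt a b.
have: regular (fun v => \sum_j s v a j * t v j b).
  by apply: regular_sum => j _; apply: regularM.
by move/regular_ext; apply=> v; rewrite mxE.
Qed.

Lemma mxregular_sum p q (I : Type) (r : seq I) (P : pred I)
    (F : I -> V -> 'M[k]_(p, q)) :
  (forall i, mxregular (F i)) -> mxregular (fun v => \sum_(i <- r | P i) F i v).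
Proof.
move=> rF a b; have: regular (fun v => \sum_(i <- r | P i) F i v a b).
  by apply: regular_sum => i _; apply: rF.
by move/regular_ext; apply=> v; rewrite summxE.
Qed.

Lemma regular_det p (s : V -> 'M[k]_p) :
  mxregular s -> regular (fun v => \det (s v)).
Proof.
move=> rs; apply: regular_sum => g _; apply: regularM; first exact: regular_const.
by apply: regular_prod => i _; apply: rs.
Qed.

Lemma mxregular_adj p (s : V -> 'M[k]_p) :
  mxregular s -> mxregular (fun v => \adj (s v)).
Proof.
move=> rs a b; pose t v := row' b (col' a (s v)).
have rt : mxregular t.
  by move=> i j; apply: (regular_ext (rs _ _)) => v; rewrite !mxE.
have := regularM (regular_const _ ((-1) ^+ (b + a))) (regular_det rt).
by move/regular_ext; apply=> v; rewrite mxE.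
Qed.

End MxRegular.

Section TupleMaps.
Variables (k : fieldType) (n : nat).
Implicit Types V W : vectType k.

Lemma mxregular_linear V p q (s : V -> 'M[k]_(p, q)) : linear s -> mxregular s.
Proof. by move=> slin a b; apply: regular_form => c u v; rewrite slin !mxE. Qed.

Lemma mxregular_entry p q (i : 'I_n) : mxregular (fun N : mxtuple k n p q => N i).
Proof. by apply: mxregular_linear => a u v; rewrite !ffunE. Qed.

Definition mxtuple_delta p q (i : 'I_n) a b : mxtuple k n p q :=
  [ffun j => if j == i then delta_mx a b else 0].

Lemma mxtuple_sum_delta p q (N : mxtuple k n p q) :
  N = \sum_i \sum_a \sum_b N i a b *: mxtuple_delta i a b.
Proof.
apply/ffunP => i; rewrite sum_ffunE (bigD1 i) //= [X in _ + X]big1 ?addr0.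
  rewrite [LHS]matrix_sum_delta sum_ffunE; apply: eq_bigr => a _.
  by rewrite sum_ffunE; apply: eq_bigr => b _; rewrite !ffunE eqxx.
move=> j ji; rewrite sum_ffunE big1 // => a _; rewrite sum_ffunE big1 // => b _.
by rewrite !ffunE eq_sym (negbTE ji) scaler0.
Qed.

Lemma regular_map_mxtuple V p q (s : V -> mxtuple k n p q) :
  (forall i, mxregular (fun v => s v i)) -> regular_map s.
Proof.
move=> rs; apply: regular_mapP => l llin.
have: regular (fun v => \sum_i \sum_a \sum_b s v i a b * l (mxtuple_delta i a b)).
  do 3![apply: regular_sum => ? _]; apply: regularM; last exact: regular_const.
  exact: rs.
move/regular_ext; apply=> v; rewrite [in RHS](mxtuple_sum_delta (s v)).
have [lD l0 lZ] := scalar_form_morph llin.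
do 3![rewrite (big_morph l lD l0); apply: eq_bigr => ? _].
by rewrite lZ.
Qed.

End TupleMaps.

Definition columns_mx (k : fieldType) (d r : nat) (X : seq 'cV[k]_d) : 'M[k]_(d, r) :=
  \matrix_(a, b) (X`_b) a 0.

Lemma col_columns_mx (k : fieldType) (d r : nat) (X : seq 'cV[k]_d) (b : 'I_r) :
  col b (columns_mx r X) = X`_b.
Proof. by apply/colP => a; rewrite !mxE. Qed.

Lemma columns_mx_full (k : fieldType) (d r : nat) (X : r.-tuple 'cV[k]_d) :
  free X -> row_full (columns_mx r X).
Proof.
move=> freeX; rewrite -cokermx_eq0; apply/eqP/trmx_inj/row_matrixP => i.
rewrite trmx0 row0 -tr_col; apply/trmx_inj; rewrite trmx0 trmxK.
have : columns_mx r X *m col i (cokermx (columns_mx r X)) = 0.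
  by rewrite colE mulmxA mulmx_coker mul0mx.
set w := col i _ => Kw0; apply/colP => b; rewrite [RHS]mxE.
apply: (freeP freeX (fun b => w b 0)).
rewrite -[RHS]Kw0; apply/colP => j; rewrite summxE !mxE; apply: eq_bigr => a _.
by rewrite !mxE mulrC.
Qed.

(** The independence of r vectors is certified by a nonvanishing determinant, which
    is what makes lower bounds on dimensions open conditions. *)
Lemma dimv_geP (k : fieldType) (d r : nat) (U : {vspace 'cV[k]_d}) :
  (r <= \dim U)%N <->
  exists K : 'M_(d, r), exists2 L : 'M_(r, d),
    forall b, col b K \in U & \det (L *m K) != 0.
Proof.
split=> [rU|[K [L KU detLK]]].
  have szX : size (take r (vbasis U)) == r by rewrite size_takel ?size_tuple.
  pose X := Tuple szX.
  have /columns_mx_full : free X.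
    by apply: (@catl_free _ _ (drop r (vbasis U))); rewrite cat_take_drop
      (basis_free (vbasisP U)).
  move/row_fullP => [L LK]; exists (columns_mx r X), L; last by rewrite LK det1 oner_neq0.
  move=> b; rewrite col_columns_mx vbasis_mem // (mem_take (n0 := r)) //.
  by rewrite mem_nth ?size_tuple.
pose h := linfun (mulmx K : 'cV_r -> 'cV_d).
have hU : (limg h <= U)%VS.
  apply/subvP => _ /memv_imgP[x _ ->]; rewrite lfunE /=.
  rewrite [x]matrix_sum_delta exchange_big big_ord1 /= mulmx_sumr.
  by apply: memv_suml => b _; rewrite -scalemxAr -colE memvZ.
apply: leq_trans (dimvS hU); rewrite limg_dim_eq.
  by rewrite dimvf /dim /= muln1.
apply/eqP; rewrite -subv0; apply/subvP => x; rewrite memv_cap memv_ker lfunE memv0 /=.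
move=> /andP[_ /eqP Kx0]; apply/eqP.
have LKu : L *m K \in unitmx by rewrite unitmxE unitfE.
by rewrite -[x](mulKmx LKu) -mulmxA Kx0 !mulmx0.
Qed.

Section RadOpen.
Variables (k : fieldType) (n d r : nat).

(** The regular families sum_w M_w K_w with w running over the words of length i
    and K_w constant.  For fixed M, they give all matrices with r columns in
    rad^i M. *)
Inductive rad_columns : nat -> (mxtuple k n d d -> 'M[k]_(d, r)) -> Prop :=
| rad_columns0 K : rad_columns 0 (fun=> K)
| rad_columnsS i s : (forall j, rad_columns i (s j)) ->
    rad_columns i.+1 (fun M => \sum_j M j *m s j M).

Lemma rad_space_colsS i (M : mxtuple k n d d) (K : 'M_(d, r)) :
    (forall b, col b K \in rad_space M i.+1) ->
  exists2 K' : 'I_n -> 'M_(d, r), forall j b, col b (K' j) \in rad_space M i &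
    K = \sum_j M j *m K' j.
Proof.
move=> KR; have /fin_all_exists[v vP] (b : 'I_r) : exists v : 'I_n -> 'cV[k]_d,
    (forall j, v j \in rad_space M i) /\ col b K = \sum_j M j *m v j.
  by have /mem_rad_spaceS[v vR Kv] := KR b; exists v.
exists (fun j => \matrix_(a, b) v b j a 0) => [j b|].
  have [vR _] := vP b; rewrite (_ : col b _ = v b j) //.
  by apply/colP => a; rewrite !mxE.
apply/matrixP => a b; have [_ /colP/(_ a)] := vP b; rewrite mxE => ->.
rewrite !summxE; apply: eq_bigr => j _.
by rewrite !mxE; apply: eq_bigr => l _; rewrite mxE.
Qed.

Lemma rad_columns_regular i s : rad_columns i s -> mxregular s.
Proof.
elim=> [K|{}i {}s _ IH]; first exact: mxregular_const.
by apply: mxregular_sum => j; apply: mxregularM; first exact: mxregular_entry.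
Qed.

Lemma rad_columns_mem i s M b : rad_columns i s -> col b (s M) \in rad_space M i.
Proof.
move=> cs; elim: cs b => [K|{}i {}s _ IH] b; first exact: memvf.
apply/mem_rad_spaceS; exists (fun j => col b (s j M)) => //.
by rewrite raddf_sum; apply: eq_bigr => j _; rewrite /= !colE mulmxA.
Qed.

Lemma rad_columns_exists i M (K : 'M_(d, r)) :
  (forall b, col b K \in rad_space M i) -> exists2 s, rad_columns i s & s M = K.
Proof.
elim: i K => [|i IH] K KR; first by exists (fun=> K) => //; constructor.
have [K' K'R ->] := rad_space_colsS KR.
have /fin_all_exists[s sP] (j : 'I_n) : exists s, rad_columns i s /\ s M = K' j.
  by have [s cs sM] := IH _ (K'R j); exists s.
exists (fun M0 : mxtuple k n d d => \sum_j M0 j *m s j M0).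
  by constructor=> j; have [] := sP j.
by apply: eq_bigr => j _; have [_ ->] := sP j.
Qed.

(** The functions det(L s(M)), for s in rad_columns and L constant, detect the
    bound. *)
Lemma rad_dim_ge_open i :
  zariski_open (fun M : mxtuple k n d d => (r <= \dim (rad_space M i))%N).
Proof.
apply: (@zariski_open_nonzeros _ _ (fun f => exists s (L : 'M_(r, d)),
    rad_columns i s /\ f = fun M => \det (L *m s M))).
  move=> _ [s [L [cs ->]]]; apply: regular_det; apply: mxregularM.
    exact: mxregular_const.
  exact: rad_columns_regular cs.
move=> M; rewrite dimv_geP; split.
  move=> [K [L /rad_columns_exists[s cs sM] detLK]].
  by exists (fun M => \det (L *m s M)); [exists s, L | rewrite sM].
move=> [_ [s [L [cs ->]]] nz]; exists (s M), L => // b.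
exact: rad_columns_mem.
Qed.

End RadOpen.

(** * Peeling off the top radical layer *)

Section StdFlag.
Variable k : fieldType.

Lemma std_flag0 d : std_flag k d 0 = 0%VS.
Proof.
apply/vspaceP => u; rewrite memv0; apply/mem_std_flag/eqP => [u0|-> j _].
  by apply/colP => j; rewrite u0 // mxE.
by rewrite mxE.
Qed.

Lemma std_flag_full d D : (d <= D)%N -> std_flag k d D = fullv.
Proof.
move=> dD; apply/vspaceP => u; rewrite memvf; apply/mem_std_flag => j Dj.
by have := leq_ltn_trans (leq_trans dD Dj) (ltn_ord j); rewrite ltnn.
Qed.

Lemma dim_std_flag d D : (D <= d)%N -> \dim (std_flag k d D) = D.
Proof.
move=> Dd; apply/eqP; rewrite eqn_leq; apply/andP; split.
  apply: leq_trans (dim_span _) _; rewrite size_map size_filter -sum1_count.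
  by rewrite big_enum_cond /= -(big_ord_widen _ (fun=> 1%N)) // sum1_card card_ord.
apply/dimv_geP; pose K : 'M[k]_(d, D) := \matrix_(i, j) (i == j :> nat)%:R.
exists K, K^T.
  by move=> b; apply/mem_std_flag => j Dj; rewrite !mxE gtn_eqF // (leq_trans _ Dj).
suff -> : K^T *m K = 1%:M by rewrite det1 oner_neq0.
apply/matrixP => i j; rewrite !mxE (bigD1 (widen_ord Dd i)) //= !mxE eqxx mul1r.
rewrite big1 ?addr0 // => l li; rewrite !mxE; case: eqP => [e|]; last by rewrite mul0r.
by case/eqP: li; apply: val_inj.
Qed.

Lemma std_flag_col_mx e d0 D (w : 'cV[k]_e) : (D <= e)%N ->
  (col_mx w 0 \in std_flag k (e + d0) D) = (w \in std_flag k e D).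
Proof.
move=> De; apply/mem_std_flag/mem_std_flag => w0 j Dj.
  by have := w0 (lshift d0 j) Dj; rewrite col_mxEu.
case: (splitP j) Dj => [a ja|a ja] Dj.
  have -> : j = lshift d0 a by apply: val_inj.
  by rewrite col_mxEu w0 // -ja.
have -> : j = rshift e a by apply: val_inj.
by rewrite col_mxEd mxE.
Qed.

Lemma mem_std_flag_col_mx e d0 D (u : 'cV[k]_(e + d0)) : (D <= e)%N ->
  u \in std_flag k (e + d0) D -> u = col_mx (usubmx u) 0.
Proof.
move=> De /mem_std_flag u0; rewrite -[LHS]vsubmxK; congr col_mx.
apply/colP => j; rewrite !mxE; apply: u0.
by rewrite /= (leq_trans De) ?leq_addr.
Qed.

End StdFlag.

Lemma sumn_drop_leq i (s : seq nat) : (sumn (drop i s) <= sumn s)%N.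
Proof. by rewrite -{2}(cat_take_drop i s) sumn_cat leq_addl. Qed.

Section Block.
Variables (k : fieldType) (n e d0 : nat).
Implicit Types (M : mxtuple k n e e) (N : mxtuple k n e d0).
Implicit Types (P : mxtuple k n (e + d0) (e + d0)).

Lemma mul_block_tuple M N j q (u : 'M_(e, q)) v :
  block_tuple (M, N) j *m col_mx u v = col_mx (M j *m u + N j *m v) 0.
Proof. by rewrite ffunE mul_block_col !mul0mx addr0. Qed.

Lemma sum_col_mx0 (I : finType) q (F : I -> 'M[k]_(e, q)) :
  \sum_i col_mx (F i) (0 : 'M_(d0, q)) = col_mx (\sum_i F i) 0.
Proof.
apply/esym/(big_morph (fun A => col_mx A (0 : 'M_(d0, q)))); last exact: col_mx0.
by move=> A B; rewrite add_col_mx addr0.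
Qed.

Lemma relation_act_block c M N :
  relation_act c (block_tuple (M, N)) =
  block_mx (relation_act c M) (\sum_i linear_comb_act c M i *m N i) 0 0.
Proof.
have act i q (u : 'M_(e, q)) : linear_comb_act c (block_tuple (M, N)) i *m col_mx u 0
    = col_mx (linear_comb_act c M i *m u) 0.
  rewrite /linear_comb_act !mulmx_suml -sum_col_mx0; apply: eq_bigr => j _.
  rewrite -!scalemxAl mul_block_tuple mulmx0 addr0.
  by rewrite scale_col_mx scaler0.
transitivity (\sum_i col_mx (linear_comb_act c M i *m row_mx (M i) (N i))
                            (0 : 'M_(d0, e + d0))).
  by apply: eq_bigr => i _; rewrite -act ffunE block_mxEv row_mx0.
rewrite sum_col_mx0 block_mxEv row_mx0; congr col_mx.
rewrite /relation_act; under eq_bigr do rewrite mul_mx_row.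
elim/big_rec3: _ => [|i A B C _ ->]; first by rewrite row_mx0.
by rewrite add_row_mx.
Qed.

Lemma rad_space_block_sub M N :
  (rad_space (block_tuple (M, N)) 1 <= std_flag k (e + d0) e)%VS.
Proof.
apply/subvP => u /mem_rad_spaceS[v _ ->].
rewrite (eq_bigr (fun j => col_mx (M j *m usubmx (v j) + N j *m dsubmx (v j)) 0)).
  by rewrite sum_col_mx0 std_flag_col_mx // std_flag_full // memvf.
by move=> j _; rewrite -{1}[v j]vsubmxK mul_block_tuple.
Qed.

(** Since block tuples vanish on the last d0 coordinates, rad^(i+1) of the large
    module is rad^i of the small one as soon as rad itself is the full first
    block. *)
Lemma rad_space_block M N i (u : 'cV_(e + d0)) :
    rad_space (block_tuple (M, N)) 1 = std_flag k (e + d0) e ->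
  (u \in rad_space (block_tuple (M, N)) i.+1) <->
  (exists2 w, w \in rad_space M i & u = col_mx w 0).
Proof.
move=> rad1; elim: i u => [|i IH] u.
  rewrite rad1; split=> [u_in|[w _ ->]].
    by exists (usubmx u); [exact: memvf | exact: mem_std_flag_col_mx u_in].
  by rewrite std_flag_col_mx // std_flag_full // memvf.
split=> [/mem_rad_spaceS[v v_in ->]|[w /mem_rad_spaceS[v v_in ->] ->]].
  have /fin_all_exists[w wP] (j : 'I_n) :
      exists w, w \in rad_space M i /\ v j = col_mx w 0.
    by have /IH[w w_in ->] := v_in j; exists w.
  exists (\sum_j M j *m w j).
    by apply/mem_rad_spaceS; exists w => // j; have [] := wP j.
  rewrite -sum_col_mx0; apply: eq_bigr => j _; have [_ ->] := wP j.
  by rewrite mul_block_tuple mulmx0 addr0.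
apply/mem_rad_spaceS; exists (fun j => col_mx (v j) 0).
  by move=> j; apply/IH; exists (v j).
rewrite -sum_col_mx0; apply: eq_bigr => j _.
by rewrite mul_block_tuple mulmx0 addr0.
Qed.

Lemma rad_space_std_flag_block P :
    (rad_space P 1 <= std_flag k (e + d0) e)%VS ->
  exists M N, P = block_tuple (M, N).
Proof.
move=> Pe; exists [ffun i => ulsubmx (P i)], [ffun i => ursubmx (P i)].
apply/ffunP => i; rewrite !ffunE -[LHS]submxK.
have rows0 (a : 'I_d0) b : P i (rshift e a) b = 0.
  have := subvP Pe _ (mem_rad_space_act (M := P) (i := 0) i (memvf (delta_mx b 0))).
  by move/mem_std_flag/(_ (rshift e a)); rewrite -colE mxE; apply; rewrite leq_addr.
by congr block_mx; apply/matrixP => a b; rewrite !mxE rows0.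
Qed.

(** The rows of P below e vanish because rad P is the span of the first e basis
    vectors; the remaining conditions on the flag shift by one step.  For
    a block tuple rad P always lies in that span, so the dimension bound is
    what forces equality. *)
Lemma rep_flag_block c m (dd : seq nat) P :
    e = sumn dd -> (size dd < m)%N ->
  rep_flag c m (d0 :: dd) P <->
  exists M N, [/\ P = block_tuple (M, N), rep_flag c m dd M,
    \sum_i linear_comb_act c M i *m N i = 0 & (e <= \dim (rad_space P 1))%N].
Proof.
move=> edd szm; split=> [/rep_flagP[R0 rel0 fl]|[M [N [-> /rep_flagP[R0 rel0 fl] MN0 dimR]]]].
  have rad1 : rad_space P 1 = std_flag k (e + d0) e by rewrite fl /= drop0 edd.
  have [M [N defP]] : exists M N, P = block_tuple (M, N).
    by apply: rad_space_std_flag_block; rewrite rad1.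
  move: R0 rel0 fl rad1; rewrite {}defP => R0 rel0 fl rad1; exists M, N.
  have memR i w : (w \in rad_space M i) =
      (col_mx w (0 : 'cV_d0) \in rad_space (block_tuple (M, N)) i.+1).
    apply/idP/idP => [w_in|]; first by apply/rad_space_block => //; exists w.
    by move/(rad_space_block _ _ rad1) => [w' w'_in /eq_col_mx[-> _]].
  move: rel0; rewrite relation_act_block => /eqP.
  rewrite -(block_mx0 k e d0 e d0) => /eqP/eq_block_mx[relM relMN _ _].
  split=> //; last by rewrite rad1 dim_std_flag // leq_addr.
  apply/rep_flagP; split=> // [|i].
    apply/eqP; rewrite -subv0; apply/subvP => w; rewrite memR.
    move/(subvP (rad_space_decr _ _)); rewrite R0 !memv0 -(col_mx0 k e d0 1).
    by move/eqP/eq_col_mx => [-> _].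
  apply/vspaceP => w; rewrite memR fl /= std_flag_col_mx //.
  by rewrite edd sumn_drop_leq.
have rad1 : rad_space (block_tuple (M, N)) 1 = std_flag k (e + d0) e.
  apply/eqP; rewrite eqEdim rad_space_block_sub dim_std_flag ?leq_addr //.
apply/rep_flagP; split.
- case: m szm R0 => // m szm _; apply/eqP; rewrite -subv0; apply/subvP => u.
  move/(rad_space_block _ _ rad1) => [w]; rewrite fl drop_oversize // std_flag0.
  by rewrite !memv0 => /eqP-> ->; rewrite col_mx0.
- by rewrite relation_act_block rel0 MN0 block_mx0.
case=> [|i]; first by rewrite /= std_flag_full // addnC edd.
have Di : (sumn (drop i dd) <= e)%N by rewrite edd sumn_drop_leq.
rewrite /=; apply/vspaceP => u; apply/idP/idP.
  by move/(rad_space_block _ _ rad1) => [w]; rewrite fl => w_in ->;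
    rewrite std_flag_col_mx.
move=> u_in; apply/(rad_space_block _ _ rad1); exists (usubmx u).
  by rewrite fl -(std_flag_col_mx d0) // -(mem_std_flag_col_mx Di u_in).
exact: mem_std_flag_col_mx u_in.
Qed.

End Block.

(** * Irreducibility of the kernel of Phi *)

Section Kernel.
Variables (k : closedFieldType) (n : nat) (c : 'M[k]_n).
Hypothesis c_unit : c \in unitmx.

(** The x_j are in turn linear combinations of the a_i, which is how the images of
    the a_i(M) come to span rad M. *)
Lemma linear_comb_act_inv d (M : mxtuple k n d d) j :
  M j = \sum_i invmx c j i *: linear_comb_act c M i.
Proof.
rewrite /linear_comb_act; under eq_bigr do rewrite scaler_sumr.
rewrite exchange_big (bigD1 j) //= [X in _ + X]big1 => [|l lj].
  rewrite addr0; under eq_bigr do rewrite scalerA.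
  rewrite -scaler_suml; have /matrixP/(_ j j) := mulVmx c_unit.
  by rewrite !mxE eqxx => ->; rewrite scale1r.
under eq_bigr do rewrite scalerA.
rewrite -scaler_suml; have /matrixP/(_ j l) := mulVmx c_unit.
by rewrite !mxE eq_sym (negbTE lj) => ->; rewrite scale0r.
Qed.

(** Let A(M) = (a_1(M), ..., a_n(M)) act on stacked blocks N, let Q be the projection
    onto rad M, and choose K with A(M0) K = Q.  Put T(M) = A(M) K + 1 - Q, so that
    T(M0) = 1 and Q T(M) = A(M) K.  The section through (M0, N0) is
    s(M) = det T(M) N0 - K adj(T(M)) A(M) N0; indeed A(M) s(M) =
    det T(M) A(M) N0 - Q T(M) adj(T(M)) A(M) N0 = 0, because Q fixes A(M) N0. *)
Lemma opens_meet_kernel m (dd : seq nat) e d0 : e = sumn dd ->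
    opens_meet (fun M : mxtuple k n e e => rep_flag c m dd M) ->
  opens_meet (fun MN : mxtuple k n e e * mxtuple k n e d0 =>
    rep_flag c m dd MN.1 /\ \sum_i linear_comb_act c MN.1 i *m MN.2 i = 0).
Proof.
move=> edd mB; apply: (opens_meet_fibration mB) => [M BM|M N [] //|M0 N0 [BM0 MN0]].
  apply: opens_meet_subspace => a N N' [_ EN] [_ EN']; split=> //=.
  transitivity (a *: (\sum_i linear_comb_act c M i *m N i)
                + \sum_i linear_comb_act c M i *m N' i).
    rewrite scaler_sumr -big_split /=; apply: eq_bigr => i _.
    by rewrite !ffunE mulmxDr -scalemxAr.
  by rewrite EN EN' scaler0 addr0.
(* D is the dimension of rad M for every M in the base. *)
rewrite /= in BM0 MN0; set D := sumn (drop 1 dd); pose Q : 'M[k]_e := pid_mx D.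
have fixQ q M (N : 'I_n -> 'M_(e, q)) : rep_flag c m dd M ->
    Q *m (\sum_i linear_comb_act c M i *m N i) = \sum_i linear_comb_act c M i *m N i.
  move=> /rep_flagP[_ _ /(_ 1%N)] rad1; set Y := \sum_i _.
  have Y0 (a : 'I_e) b : (D <= a)%N -> Y a b = 0.
    have: col b Y \in rad_space M 1.
      rewrite colE mulmx_suml; apply: memv_suml => i _.
      rewrite /linear_comb_act !mulmx_suml; apply: memv_suml => j _.
      by rewrite -!scalemxAl memvZ // -mulmxA mem_rad_space_act ?memvf.
    by rewrite rad1 => /mem_std_flag/(_ a); rewrite mxE.
  apply/matrixP => a b; rewrite mxE (bigD1 a) //= big1 ?addr0 => [|l la].
    by rewrite mxE eqxx /=; case: ltnP => [_|/Y0->]; rewrite ?mul1r ?mulr0.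
  by rewrite mxE eq_sym (inj_eq val_inj) (negbTE la) mul0r.
have [K QK] : exists K : 'I_n -> 'M[k]_e, \sum_i linear_comb_act c M0 i *m K i = Q.
  have [|s _ Qs] := @rad_space_colsS _ _ _ _ 0 M0 Q.
    move=> b; have /rep_flagP[_ _ ->] := BM0; apply/mem_std_flag => j Dj.
    by rewrite !mxE ltnNge Dj andbF.
  (* Q = sum_j M0_j s_j is rewritten in terms of the a_i(M0). *)
  exists (fun i => \sum_j invmx c j i *: s j).
  under eq_bigr do rewrite mulmx_sumr; rewrite exchange_big Qs.
  apply: eq_bigr => j _; rewrite [in RHS](linear_comb_act_inv M0) mulmx_suml.
  by apply: eq_bigr => i _; rewrite -scalemxAr -scalemxAl.
pose T M := \sum_i linear_comb_act c M i *m K i + (1%:M - Q).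
have T0 : T M0 = 1%:M by rewrite /T QK addrC subrK.
have QT M : rep_flag c m dd M -> Q *m T M = \sum_i linear_comb_act c M i *m K i.
  move=> BM; rewrite mulmxDr fixQ // mulmxBr mulmx1.
  by rewrite -{3}QK fixQ // QK subrr addr0.
have rA i : mxregular (fun M : mxtuple k n e e => linear_comb_act c M i).
  apply: mxregular_sum => j; apply: mxregularZ; first exact: regular_const.
  exact: mxregular_entry.
have rT : mxregular T.
  apply: mxregularD; last exact: mxregular_const.
  by apply: mxregular_sum => i; apply: mxregularM => //; apply: mxregular_const.
exists (fun M => [ffun i => \det (T M) *: N0 i -
  K i *m \adj (T M) *m (\sum_j linear_comb_act c M j *m N0 j)]); split.
- apply: regular_map_mxtuple => i.
  apply: (@mxregular_ext _ _ _ _ (fun M => \det (T M) *: N0 i -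
    K i *m \adj (T M) *m (\sum_j linear_comb_act c M j *m N0 j))); last first.
    by move=> M; rewrite ffunE.
  apply: mxregularD; first by apply: mxregularZ; [exact: regular_det|exact: mxregular_const].
  apply/mxregularN/mxregularM.
    by apply: mxregularM; [exact: mxregular_const|exact: mxregular_adj].
  by apply: mxregular_sum => j; apply: mxregularM => //; apply: mxregular_const.
- by apply/ffunP => i; rewrite ffunE MN0 mulmx0 subr0 T0 det1 scale1r.
move=> M BM; split=> //=; set Y := \sum_j linear_comb_act c M j *m N0 j.
transitivity (\det (T M) *: Y -
    (\sum_i linear_comb_act c M i *m K i) *m \adj (T M) *m Y).
  rewrite scaler_sumr !mulmx_suml -sumrB; apply: eq_bigr => i _.
  by rewrite ffunE mulmxBr -scalemxAr !mulmxA.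
rewrite -QT // -(mulmxA Q) mul_mx_adj mul_mx_scalar -scalemxAl /Y fixQ //.
by rewrite subrr.
Qed.

End Kernel.

(** * Strata with a prescribed flag and their orbits *)

Lemma linear_comb_unitmx (k : fieldType) (n : nat) (c : 'M[k]_n) :
  @linearly_independent k (free_algebra k n) n (linear_comb c) -> c \in unitmx.
Proof.
move=> hc; rewrite -row_free_unit; apply: inj_row_free => v vc0.
apply/rowP => i; rewrite mxE; apply: (hc (v 0)).
rewrite /linear_comb; under eq_bigr do rewrite scaler_sumr.
rewrite exchange_big big1 // => j _; under eq_bigr do rewrite scalerA.
rewrite -scaler_suml; have /rowP/(_ j) := vc0.
by rewrite !mxE => ->; rewrite scale0r.
Qed.

Section Conjugation.
Variables (k : fieldType) (n d : nat) (s : k) (g : 'M[k]_d).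
Variables (M M' : mxtuple k n d d).
Hypotheses (s_neq0 : s != 0) (g_unit : g \in unitmx).
Hypothesis M'E : forall i, M' i = s *: (g *m M i *m invmx g).

(** The extra scalar s serves both for conjugation by g and, with g = 1, for
    scaling. *)
Lemma mem_rad_space_conj i u : (u \in rad_space M' i) = (invmx g *m u \in rad_space M i).
Proof.
elim: i u => [|i IH] u; first by rewrite !memvf.
apply/mem_rad_spaceS/mem_rad_spaceS => -[v v_in uE].
  exists (fun j => s *: (invmx g *m v j)) => [j|]; first by rewrite memvZ // -IH.
  rewrite uE mulmx_sumr; apply: eq_bigr => j _; rewrite M'E.
  by rewrite -scalemxAl -!scalemxAr !mulmxA mulVmx // mul1mx.
exists (fun j => s^-1 *: (g *m v j)) => [j|]; first by rewrite IH -scalemxAr mulKmx ?memvZ.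
rewrite -[LHS](mulKVmx g_unit) uE mulmx_sumr; apply: eq_bigr => j _; rewrite M'E.
by rewrite -scalemxAl -scalemxAr scalerA mulfV // scale1r -!mulmxA mulKmx.
Qed.

Lemma relation_act_conj c :
  relation_act c M' = (s * s) *: (g *m relation_act c M *m invmx g).
Proof.
rewrite mulmx_sumr mulmx_suml scaler_sumr; apply: eq_bigr => i _.
have -> : linear_comb_act c M' i = s *: (g *m linear_comb_act c M i *m invmx g).
  rewrite mulmx_sumr mulmx_suml scaler_sumr; apply: eq_bigr => j _.
  by rewrite M'E -scalemxAr -scalemxAl !scalerA mulrC.
by rewrite M'E -scalemxAr -scalemxAl scalerA -!mulmxA mulKmx.
Qed.

Lemma dim_rad_space_conj i : \dim (rad_space M' i) = \dim (rad_space M i).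
Proof.
pose h := linfun (mulmx g : 'cV_d -> 'cV_d).
have -> : rad_space M' i = (h @: rad_space M i)%VS.
  apply/vspaceP => u; rewrite mem_rad_space_conj; apply/idP/memv_imgP => [u_in|].
    by exists (invmx g *m u) => //; rewrite lfunE /= mulKVmx.
  by move=> [w w_in ->]; rewrite lfunE /= mulKmx.
apply: limg_dim_eq; apply/eqP; rewrite -subv0; apply/subvP => x.
rewrite memv_cap memv_ker lfunE memv0 /= => /andP[_ /eqP gx0].
by rewrite -[x](mulKmx g_unit) gx0 mulmx0.
Qed.

Lemma rad_space_conj_eq0 i : (rad_space M' i == 0%VS) = (rad_space M i == 0%VS).
Proof. by rewrite -!dimv_eq0 dim_rad_space_conj. Qed.

End Conjugation.

Section BlockOpen.
Variables (k : fieldType) (n e d0 : nat).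

Lemma block_tuple_regular : regular_map (@block_tuple k n e d0).
Proof.
apply: regular_map_linear => a x y; apply/ffunP => i; rewrite !ffunE.
by rewrite scale_block_mx add_block_mx !scaler0 !addr0.
Qed.

Lemma rad_block_open :
  zariski_open (fun MN : mxtuple k n e e * mxtuple k n e d0 =>
    (e <= \dim (rad_space (block_tuple MN) 1))%N).
Proof.
exact: (zariski_open_preimage block_tuple_regular (@rad_dim_ge_open k n _ e 1)).
Qed.

End BlockOpen.

Section Strata.
Variables (k : closedFieldType) (n : nat) (c : 'M[k]_n) (m : nat).

Lemma rep_flag_scale d dd s (M M' : mxtuple k n d d) :
  s != 0 -> (forall i, M' i = s *: M i) -> rep_flag c m dd M -> rep_flag c m dd M'.
Proof.
move=> s0 M'E /rep_flagP[R0 rel0 fl].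
have conjE i : M' i = s *: (1%:M *m M i *m invmx 1%:M).
  by rewrite M'E mul1mx invmx1 mulmx1.
have RE i : rad_space M' i = rad_space M i.
  apply/vspaceP => u; rewrite (mem_rad_space_conj s0 (unitmx1 _ _) conjE).
  by rewrite invmx1 mul1mx.
apply/rep_flagP; split=> [||i]; rewrite ?RE //.
by rewrite (relation_act_conj (unitmx1 _ _) conjE) rel0 mulmx0 mul0mx scaler0.
Qed.

Hypothesis c_unit : c \in unitmx.

Lemma opens_meet_rep_flag dd d : d = sumn dd -> (size dd <= m)%N ->
  opens_meet (fun M : mxtuple k n d d => rep_flag c m dd M).
Proof.
elim: dd d => [|d0 dd IH] d dE sz /=.
  (* There is only one tuple of 0 x 0 matrices. *)
  move=> f g _ _ x y Xx _ fx gy; exists x; split=> //.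
  rewrite (_ : x = y) //; apply/ffunP => i; move: x y {f g Xx fx gy}.
  by rewrite dE => x y; rewrite [x i]flatmx0 [y i]flatmx0.
have {dE}-> : d = (sumn dd + d0)%N by rewrite dE addnC.
have := opens_meet_image (@block_tuple_regular k n (sumn dd) d0)
  (opens_meet_open (@rad_block_open k n (sumn dd) d0)
  (opens_meet_kernel (d0 := d0) c_unit (erefl (sumn dd)) (IH _ (erefl _) (ltnW sz)))).
apply: opens_meet_ext => P; rewrite rep_flag_block //.
split=> [[[M N] [UMN [BM MN0]] ->]|[M [N [-> BM MN0 UMN]]]]; first by exists M, N.
by exists (M, N).
Qed.

(** g M g^-1 = g ((det g)^-1 M) adj(g), and the scaled tuple has the same flag, so
    the orbit map can be made polynomial. *)
Lemma rep_layer_adj dd d (M : mxtuple k n d d) :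
  rep_layer c m dd M <->
  exists2 Mg : mxtuple k n d d * 'M[k]_d,
    Mg.2 \in unitmx /\ rep_flag c m dd Mg.1 &
    M = [ffun i => Mg.2 *m Mg.1 i *m \adj Mg.2].
Proof.
split=> [[g gu [M' fM' ME]]|[[M' g] /= [gu fM'] ->]].
  have det0 : \det g != 0 by rewrite -unitfE -unitmxE.
  exists ([ffun i => (\det g)^-1 *: M' i], g) => /=.
    split=> //; apply: (rep_flag_scale (s := (\det g)^-1)) fM'.
      by rewrite invr_eq0.
    by move=> i; rewrite ffunE.
  apply/ffunP => i; rewrite !ffunE ME /invmx gu.
  by rewrite -!scalemxAr -!scalemxAl.
have det0 : \det g != 0 by rewrite -unitfE -unitmxE.
exists g => //; exists [ffun i => \det g *: M' i].
  by apply: (rep_flag_scale det0) fM' => i; rewrite ffunE.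
move=> i; rewrite !ffunE /invmx gu -!scalemxAr -!scalemxAl scalerA.
by rewrite mulVf // scale1r.
Qed.

(** The product of rep(dd, A) with Mat_d is a trivial bundle, in which the condition
    that g be invertible is open. *)
Lemma opens_meet_rep_layer dd d : d = sumn dd -> (size dd <= m)%N ->
  opens_meet (fun M : mxtuple k n d d => rep_layer c m dd M).
Proof.
move=> dE sz.
have mE : opens_meet (fun Mg : mxtuple k n d d * 'M[k]_d => rep_flag c m dd Mg.1).
  apply: (opens_meet_fibration (opens_meet_rep_flag dE sz)) => // [M BM|M g BM].
    by apply: opens_meet_subspace.
  by exists (fun=> g); split=> //; apply: regular_map_const.
have r1 i : mxregular (fun Mg : mxtuple k n d d * 'M[k]_d => Mg.1 i).
  by apply: mxregular_linear => a x y; rewrite !ffunE.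
have r2 : mxregular (fun Mg : mxtuple k n d d * 'M[k]_d => Mg.2).
  exact: mxregular_linear.
have oG : zariski_open (fun Mg : mxtuple k n d d * 'M[k]_d => Mg.2 \in unitmx).
  apply: (@zariski_open_nonzeros _ _ (fun f => f = fun Mg => \det Mg.2)).
    by move=> _ ->; apply: regular_det.
  move=> Mg; rewrite unitmxE unitfE; split=> [nz|[_ -> //]].
  by exists (fun Mg => \det Mg.2).
have rc : regular_map (fun Mg : mxtuple k n d d * 'M[k]_d =>
    [ffun i => Mg.2 *m Mg.1 i *m \adj Mg.2] : mxtuple k n d d).
  apply: regular_map_mxtuple => i.
  apply: (@mxregular_ext _ _ _ _ (fun Mg : mxtuple k n d d * 'M[k]_d =>
    Mg.2 *m Mg.1 i *m \adj Mg.2)); last by move=> Mg; rewrite ffunE.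
  apply: mxregularM; last exact: mxregular_adj.
  exact: mxregularM.
apply: opens_meet_ext (opens_meet_image rc (opens_meet_open oG mE)) => M.
by rewrite rep_layer_adj.
Qed.

End Strata.

(** * Strata by radical layering *)

Lemma sumn_drop_nth i (s : seq nat) :
  sumn (drop i s) = (sumn (drop i.+1 s) + nth 0 s i)%N.
Proof.
have [lt|ge] := ltnP i (size s); first by rewrite (drop_nth 0%N) //= addnC.
by rewrite !drop_oversize ?nth_default // leqW.
Qed.

(** Starting from the smallest term, each basis is extended by a basis of a
    complement in the next larger term. *)
Lemma chain_basis (k : fieldType) (V : vectType k) (R : nat -> {vspace V}) m :
    (forall i, (R i.+1 <= R i)%VS) -> R m = 0%VS ->
  exists2 X : seq V, basis_of (R 0) X &
    forall j, (j <= m)%N -> basis_of (R j) (take (\dim (R j)) X).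
Proof.
move=> Rdec Rm; have Rle j p : (p <= j)%N -> (R j <= R p)%VS.
  elim: j => [|j IH]; first by rewrite leqn0 => /eqP->.
  by rewrite leq_eqVlt => /predU1P[->//|/IH]; apply: subv_trans.
suff H t : (t <= m)%N -> exists2 X : seq V, basis_of (R (m - t)%N) X &
    forall j, (m - t <= j <= m)%N -> basis_of (R j) (take (\dim (R j)) X).
  by have [X] := H m (leqnn m); rewrite subnn => bX tX; exists X.
elim: t => [_|t IH tm].
  exists [::]; rewrite ?subn0; first by rewrite Rm nil_basis.
  by move=> j; rewrite -eqn_leq => /eqP<-; rewrite Rm nil_basis.
have [X bX tX] := IH (ltnW tm).
set p := (m - t.+1)%N; have pS : p.+1 = (m - t)%N by rewrite /p subnSK.
have bY : basis_of (R p) (X ++ vbasis (R p :\: R p.+1)).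
  have -> : R p = (R p.+1 + (R p :\: R p.+1))%VS.
    by rewrite addvC addv_diff (addv_idPl _).
  apply: cat_basis; [by apply/directv_addP; rewrite capvC capv_diff
                    |by rewrite pS|].
  have -> : (R p.+1 + (R p :\: R p.+1))%VS = R p.
    by rewrite addvC addv_diff (addv_idPl _).
  exact: vbasisP.
exists (X ++ vbasis (R p :\: R p.+1)) => // j.
have szX := vector.size_basis (X := in_tuple X) bX.
have szY := vector.size_basis (X := in_tuple _) bY.
rewrite leq_eqVlt => /andP[/predU1P[<- _|pj jm]]; first by rewrite szY take_size.
rewrite takel_cat; first by rewrite tX // -pS pj.
by rewrite -szX -pS dimvS // Rle.
Qed.

Section Layers.
Variables (k : fieldType) (n : nat) (c : 'M[k]_n) (m : nat).

Lemma rad_space_eq0_leq d (M : mxtuple k n d d) i j :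
  (i <= j)%N -> rad_space M i = 0%VS -> rad_space M j = 0%VS.
Proof.
move=> /subnK<- Ri; elim: (j - i)%N => // t IH.
by apply/eqP; rewrite -subv0 -IH rad_space_decr.
Qed.

Lemma radical_layeringP d (M : mxtuple k n d d) dd :
    rad_space M m = 0%VS -> (size dd <= m)%N ->
  radical_layering M dd <-> forall i, \dim (rad_space M i) = sumn (drop i dd).
Proof.
move=> R0 sz.
split=> [lay|dimR i]; last first.
  exists (rad_space M i), (rad_space M i.+1).
  by split=> [u|u|]; rewrite ?rad_spaceP // !dimR -sumn_drop_nth.
have step i : \dim (rad_space M i) = (\dim (rad_space M i.+1) + nth 0 dd i)%N.
  have [U [W [defU defW dimU]]] := lay i.
  have -> : rad_space M i = U.
    by apply/vspaceP => u; apply/idP/idP => [/rad_spaceP/defU|/defU/rad_spaceP].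
  suff -> : rad_space M i.+1 = W by [].
  by apply/vspaceP => u; apply/idP/idP => [/rad_spaceP/defW|/defW/rad_spaceP].
have H t : \dim (rad_space M (m - t)) = sumn (drop (m - t) dd).
  elim: t => [|t IH]; first by rewrite subn0 R0 dimv0 drop_oversize.
  have [tm|mt] := ltnP t m; first by rewrite step sumn_drop_nth subnSK // IH.
  by move: mt; rewrite -subn_eq0 subnS => /eqP mt; rewrite mt in IH *.
move=> i; have [im|mi] := leqP i m; first by rewrite -(subKn im) H.
by rewrite (rad_space_eq0_leq (ltnW mi)) // dimv0 drop_oversize // (leq_trans sz) // ltnW.
Qed.

(** Conjugating by a matrix whose columns form a basis adapted to the radical
    filtration turns that filtration into the standard flag. *)
Lemma rep_layerP d (M : mxtuple k n d d) dd :
    sumn dd = d -> (size dd <= m)%N ->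
  rep_layer c m dd M <->
  relation_act c M = 0 /\ forall i, \dim (rad_space M i) = sumn (drop i dd).
Proof.
move=> dE sz; split=> [[g gu [M' /rep_flagP[R0 rel0 fl] ME]]|[rel0 dimR]].
  have ME1 i : M i = 1 *: (g *m M' i *m invmx g) by rewrite scale1r ME.
  have one0 : (1 : k) != 0 := oner_neq0 _.
  rewrite (relation_act_conj gu ME1) rel0 mulmx0 mul0mx scaler0; split=> // i.
  rewrite (dim_rad_space_conj one0 gu ME1) fl dim_std_flag //.
  by rewrite -[leqRHS]dE sumn_drop_leq.
have R0 : rad_space M m = 0%VS.
  by apply/eqP; rewrite -dimv_eq0 dimR drop_oversize.
have [X bX tX] := chain_basis (rad_space_decr M) R0.
have szX : size X == d.
  by have := vector.size_basis (X := in_tuple X) bX; rewrite dimvf /dim /= muln1 => <-.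
pose Xt := Tuple szX; pose g := columns_mx d Xt.
have gu : g \in unitmx by rewrite -row_full_unit columns_mx_full // (basis_free bX).
have gR i : (linfun (mulmx g : 'cV_d -> 'cV_d) @: std_flag k d (sumn (drop i dd)))%VS
    = rad_space M i.
  set h := linfun _.
  have hker : lker h = 0%VS.
    apply/eqP; rewrite -subv0; apply/subvP => x.
    rewrite memv_ker lfunE memv0 /= => /eqP gx0.
    by rewrite -[x](mulKmx gu) gx0 mulmx0.
  apply/eqP; rewrite eqEdim; apply/andP; split; last first.
    rewrite limg_dim_eq ?hker ?capv0 // dim_std_flag ?dimR //.
    by rewrite -[leqRHS]dE sumn_drop_leq.
  have [im|mi] := leqP i m; last first.
    by rewrite drop_oversize ?(leq_trans sz) ?(ltnW mi) // std_flag0 limg0 sub0v.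
  apply/subvP => _ /memv_imgP[x /mem_std_flag x0 ->]; rewrite lfunE /=.
  rewrite [x]matrix_sum_delta exchange_big big_ord1 /= mulmx_sumr.
  apply: memv_suml => b _; rewrite -scalemxAr -colE col_columns_mx.
  have [bD|Db] := ltnP b (sumn (drop i dd)); last by rewrite x0 // scale0r mem0v.
  rewrite memvZ // (basis_mem (tX i im)) // dimR -(nth_take 0 bD) mem_nth //.
  by rewrite size_takel // (eqP szX) -[leqRHS]dE sumn_drop_leq.
have gVu : invmx g \in unitmx by rewrite unitmx_inv.
pose M' : mxtuple k n d d := [ffun i => invmx g *m M i *m g].
have ME1 i : M' i = 1 *: (invmx g *m M i *m invmx (invmx g)).
  by rewrite ffunE scale1r invmxK.
have one0 : (1 : k) != 0 := oner_neq0 _.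
exists g => //; exists M'; last first.
  by move=> i; rewrite ffunE !mulmxA mulmxV // mul1mx -mulmxA mulmxV // mulmx1.
apply/rep_flagP; split=> [||i].
- by apply/eqP; rewrite (rad_space_conj_eq0 one0 gVu ME1) R0.
- by rewrite (relation_act_conj gVu ME1) rel0 mulmx0 mul0mx scaler0.
apply/vspaceP => u; rewrite (mem_rad_space_conj one0 gVu ME1) invmxK -gR.
apply/memv_imgP/idP => [[w w_in]|u_in]; last by exists u; rewrite ?lfunE.
by rewrite lfunE /= => /(can_inj (mulKmx gu))->.
Qed.

Lemma rep_layer_rep d dd (M : mxtuple k n d d) :
  sumn dd = d -> (size dd <= m)%N -> rep_layer c m dd M -> rep c m M.
Proof.
move=> dE sz /rep_layerP[] // rel0 dimR; apply/repP; split=> //.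
by apply/eqP; rewrite -dimv_eq0 dimR drop_oversize.
Qed.

Lemma rep_layer_occurs d (dd : seq nat) :
    sumn dd = d -> (size dd <= m)%N ->
  occurs c m d dd <-> nonempty (fun M : mxtuple k n d d => rep_layer c m dd M).
Proof.
move=> dE sz; split=> [[M /repP[R0 rel0] /radical_layeringP]|[M lM]].
  by move=> /(_ R0 sz) dimR; exists M; apply/rep_layerP.
exists M; first exact: rep_layer_rep lM.
have /repP[R0 _] := rep_layer_rep dE sz lM.
by apply/(radical_layeringP R0 sz); case/(rep_layerP _ dE sz): lM.
Qed.

(** The dimensions of the successive quotients of the radical filtration add up
    to d because the filtration reaches 0 after m steps. *)
Lemma rep_in_layer d (M : mxtuple k n d d) : rep c m M ->
  exists2 dd : m.-tuple nat, sumn dd = d & rep_layer c m dd M.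
Proof.
move=> /repP[R0 rel0].
pose D i := \dim (rad_space M i).
have lay : radical_layering M (mktuple (fun i : 'I_m => D i - D i.+1)%N).
  move=> i; exists (rad_space M i), (rad_space M i.+1).
  split=> [u|u|]; rewrite ?rad_spaceP //.
  have [im|mi] := ltnP i m.
    rewrite (nth_mktuple _ _ (Ordinal im)) /= subnKC //.
    exact/dimvS/rad_space_decr.
  rewrite nth_default ?size_tuple // addn0.
  by rewrite !(rad_space_eq0_leq _ R0) // leqW.
have sz : (size (mktuple (fun i : 'I_m => D i - D i.+1)%N) <= m)%N by rewrite size_tuple.
have dimR := (radical_layeringP R0 sz).1 lay.
have dE : sumn (mktuple (fun i : 'I_m => D i - D i.+1)%N) = d.
  by have := dimR 0; rewrite drop0 /= dimvf /dim /= muln1.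
by exists (mktuple (fun i : 'I_m => D i - D i.+1)%N) => //; apply/rep_layerP.
Qed.

Lemma rep_layer_inj d (dd1 dd2 : m.-tuple nat) (M : mxtuple k n d d) :
  sumn dd1 = d -> sumn dd2 = d ->
  rep_layer c m dd1 M -> rep_layer c m dd2 M -> dd1 = dd2.
Proof.
move=> dE1 dE2 /rep_layerP-/(_ dE1)[|_ dim1]; first by rewrite size_tuple.
move=> /rep_layerP-/(_ dE2)[|_ dim2]; first by rewrite size_tuple.
apply/val_inj/(@eq_from_nth _ 0%N) => /= [|i _]; first by rewrite !size_tuple.
have := sumn_drop_nth i dd1; rewrite -!dim1 !dim2 sumn_drop_nth.
by move/addnI.
Qed.

(** With D_i the tails of dd, the conditions dim rad^i M <= D_i for all i are closed
    together with the quadratic relation, and the conditions dim rad^i M >= D_i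
    for i < m are open. *)
Lemma rep_layer_quasi_affine d (dd : seq nat) :
    sumn dd = d -> (size dd <= m)%N ->
  quasi_affine (fun M : mxtuple k n d d => rep_layer c m dd M).
Proof.
move=> dE sz; pose D i := sumn (drop i dd).
exists (fun M => forall b : bool, if b then relation_act c M = 0
   else forall i, ~ (D i < \dim (rad_space M i))%N).
  apply: zariski_closedI => -[]; last first.
    by apply: zariski_closedI => i; apply: rad_dim_ge_open.
  apply: (@zariski_closed_zeros _ _ (fun f =>
            exists a b, f = fun M => relation_act c M a b)) => [_ [a [b ->]]|M].
    apply: mxregular_sum => i; apply: mxregularM; last exact: mxregular_entry.
    apply: mxregular_sum => j; apply: mxregularZ; first exact: regular_const.
    exact: mxregular_entry.
  split=> [rel0 _ [a [b ->]]|rel0]; first by rewrite rel0 mxE.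
  apply/matrixP => a b; rewrite [RHS]mxE.
  by apply: (rel0 (fun M => relation_act c M a b)); exists a, b.
exists (fun M => forall i, (i < m)%N -> (D i <= \dim (rad_space M i))%N).
  by apply: zariski_open_bigI => i; apply: rad_dim_ge_open.
move=> M; rewrite rep_layerP //; split=> [[rel0 dimR]|[ge le]].
  split=> [i _|[//|i]]; first by rewrite dimR.
  by rewrite dimR ltnn.
split=> [|i]; first exact: (le true).
have le_i : (\dim (rad_space M i) <= D i)%N.
  by rewrite leqNgt; apply/negP; apply: (le false).
apply/eqP; rewrite eqn_leq le_i /=; have [/ge//|mi] := ltnP i m.
by rewrite drop_oversize // (leq_trans sz).
Qed.

End Layers.

Theorem corollary3p5 (k : closedFieldType) (chark : 2%N \notin [pchar k])
    (m n : nat) (hm : (2 <= m)%N) (c : 'M[k]_n)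
    (hc : @linearly_independent k (free_algebra k n) n (linear_comb c)) :
  (forall dd : m.-tuple nat,
    [/\ nonempty (@ker_Phi k n c m dd) -> irreducible (@ker_Phi k n c m dd),
        exists2 X, relatively_open X (@ker_Phi k n c m dd) &
          forall P, rep_flag c m dd P <->
            exists2 MN, X MN & P = block_tuple MN,
        nonempty (@rep_flag k n c m (sumn dd) dd) ->
          irreducible (@rep_flag k n c m (sumn dd) dd) &
        nonempty (@rep_layer k n c m (sumn dd) dd) ->
          irreducible (@rep_layer k n c m (sumn dd) dd)]) /\
  (forall d : nat,
    [/\ forall M : mxtuple k n d d,
          rep c m M <->
          exists dd : m.-tuple nat,
            [/\ sumn dd = d, occurs c m d dd & rep_layer c m dd M],
        forall (dd1 dd2 : m.-tuple nat) (M : mxtuple k n d d),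
          sumn dd1 = d -> sumn dd2 = d ->
          rep_layer c m dd1 M -> rep_layer c m dd2 M -> dd1 = dd2 &
        forall dd : m.-tuple nat,
          sumn dd = d -> occurs c m d dd ->
          irreducible (@rep_layer k n c m d dd) /\
          quasi_affine (@rep_layer k n c m d dd)]).
Proof.
have c_unit := linear_comb_unitmx hc.
have sz (dd : m.-tuple nat) : (size dd <= m)%N by rewrite size_tuple.
split=> [dd|d]; split.
- apply: opens_meet_irreducible.
  have szb : (size (behead dd) <= m)%N by rewrite size_behead (leq_trans (leq_pred _)).
  have := opens_meet_kernel (d0 := head 0%N dd) c_unit (erefl _)
    (opens_meet_rep_flag c_unit (erefl _) szb).
  apply: opens_meet_ext => -[M N]; rewrite /ker_Phi /Phi /=.
  by split=> -[BM]; [move=> -> | case].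
- exists (fun MN => (sumn (behead dd) <= \dim (rad_space (block_tuple MN) 1))%N /\
                    ker_Phi c m MN).
    exists (fun MN : mxtuple k n (sumn (behead dd)) (sumn (behead dd)) *
                     mxtuple k n (sumn (behead dd)) (head 0%N dd) =>
      (sumn (behead dd) <= \dim (rad_space (block_tuple MN) 1))%N) => //.
    exact: rad_block_open.
  have szb : (size (behead dd) < m)%N by rewrite size_behead size_tuple prednK // ltnW.
  have ddE : val dd = head 0%N dd :: behead dd.
    by case: (dd) hm => -[|d0 s] //= /eqP<-.
  move=> P; rewrite [X in rep_flag c m X P]ddE rep_flag_block //.
  split=> [[M [N [-> BM MN0 dimP]]]|[[M N] [dimP [BM [MN0]]] ->]]; last by exists M, N.
  by exists (M, N) => //; split=> //; split=> //; rewrite /Phi MN0.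
- exact/opens_meet_irreducible/opens_meet_rep_flag.
- exact/opens_meet_irreducible/opens_meet_rep_layer.
- move=> M; split=> [repM|[dd [dE _ lM]]]; last exact: rep_layer_rep lM.
  have [dd dE lM] := rep_in_layer repM; exists dd; split=> //.
  by apply/rep_layer_occurs => //; exists M.
- exact: rep_layer_inj.
move=> dd dE /(rep_layer_occurs _ dE (sz dd)) ne; split.
  by apply: opens_meet_irreducible ne; apply: opens_meet_rep_layer.
exact: rep_layer_quasi_affine.
Qed.
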